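(* Let $n\ge 5$ and let $\pi$ be a partition of $n$ which is not symmetric (i.e. $\pi$ is not equal to its conjugate partition) and with $\pi\ne(1,\dots,1)$, $\pi\ne(n)$. Then the stabilizer $G(P_{\pi})=\{g\in GL(M_{n}(\mathbb{C}))\mid P_{\pi}(g(X))=P_{\pi}(X)\ \text{for all } X\}$ of the immanant $P_{\pi}$ equals $\Delta(\mathfrak{S}_{n})\ltimes T(GL_{n}\times GL_{n})\ltimes\mathbb{Z}_{2}$.
   Context: For a partition $\pi$ of $n$, let $\chi_{\pi}$ be the character of the irreducible complex representation of $\mathfrak{S}_{n}$ associated to $\pi$. The immanant is $P_{\pi}(X)=\sum_{\sigma\in\mathfrak{S}_{n}}\chi_{\pi}(\sigma)\prod_{i=1}^{n}x_{i\sigma(i)}$ for $X=(x_{ij})\in M_{n}(\mathbb{C})$. $T(GL_{n}\times GL_{n})$ is the group of pairs $(D_{1},D_{2})$ of invertible diagonal $n\times n$ matrices with $\det(D_{1})\det(D_{2})=1$, acting by $X\mapsto D_{1}XD_{2}$; $\Delta(\mathfrak{S}_{n})$ acts by $X\mapsto PXP^{-1}$ for permutation matrices $P$; $\mathbb{Z}_{2}$ acts by $X\mapsto X^{T}$. The group $\Delta(\mathfrak{S}_{n})\ltimes T(GL_{n}\times GL_{n})\ltimes\mathbb{Z}_{2}$ is the subgroup of $GL(M_{n}(\mathbb{C}))$ generated by these maps. *)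

(* Defs.v *)
From mathcomp Require Import all_boot all_order all_algebra all_fingroup.
From mathcomp Require Import mxrepresentation.
From mathcomp Require Import classical_sets reals complex.

Set Implicit Arguments.
Unset Strict Implicit.
Unset Printing Implicit Defensive.

Import Order.TTheory GRing.Theory Num.Theory.
Local Open Scope ring_scope.
Local Open Scope classical_set_scope.

Definition is_intpart (n : nat) (p : seq nat) : bool :=
  [&& sorted geq p, 0%N \notin p & sumn p == n].

Definition conj_intpart (p : seq nat) : seq nat :=
  mkseq (fun j => count (fun m => j < m)%N p) (head 0%N p).

(* The canonical tableau of shape p: the entries 0, 1, 2, ... fill the Young
   diagram row after row, so that k lies in row reshape_index p k and in
   column reshape_offset p k. *)
Definition row_stab (n : nat) (p : seq nat) : {set 'S_n} :=
  [set s : 'S_n | [forall k : 'I_n,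
     reshape_index p (s k) == reshape_index p k]].

Definition col_stab (n : nat) (p : seq nat) : {set 'S_n} :=
  [set s : 'S_n | [forall k : 'I_n,
     reshape_offset p (s k) == reshape_offset p k]].

Section Specht.

Variables (F : fieldType) (n : nat) (p : seq nat).

Local Notation G := [set: 'S_n]%G.
Local Notation aG := (regular_repr F G).

(* Young symmetrizer of the canonical tableau. As in mxrepresentation, an
   element of the group algebra F[S_n] is represented by the matrix of its
   right multiplication on F[S_n]. *)
Definition young_symmetrizer : 'M[F]_#|G| :=
  (\sum_(s in row_stab n p) aG s) *m
  (\sum_(t in col_stab n p) (-1) ^+ t *: aG t).

(* Specht module: the right ideal of F[S_n] generated by the Young
   symmetrizer. With this convention [:: n] gives the trivial representation
   and nseq n 1 the sign representation. *)
Definition specht_mx : 'M[F]_#|G| := cyclic_mx aG (gring_row young_symmetrizer).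

Definition specht_repr : mx_representation F G (\rank specht_mx) :=
  submod_repr (cyclic_mx_module aG (gring_row young_symmetrizer)).

Definition specht_char (s : 'S_n) : F := \tr (specht_repr s).

Definition immanant (X : 'M[F]_n) : F :=
  \sum_(s : 'S_n) specht_char s * \prod_(i < n) X i (s i).

End Specht.

Section MatrixGroups.

Variables (F : fieldType) (n : nat).

Local Notation End := 'End('M[F]_n).

Definition immanant_stab (p : seq nat) : set End :=
  [set g : End | bijective g /\
     forall X : 'M[F]_n, immanant p (g X) = immanant p X].

Definition diag_perm_maps : set End :=
  [set g : End | exists s : 'S_n, forall X : 'M[F]_n,
     g X = perm_mx s *m X *m invmx (perm_mx s)].

Definition torus_maps : set End :=
  [set g : End | exists D1 D2 : 'M[F]_n,
     [/\ is_diag_mx D1 && (D1 \in unitmx), is_diag_mx D2 && (D2 \in unitmx),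
         \det D1 * \det D2 = 1 &
         forall X : 'M[F]_n, g X = D1 *m X *m D2]].

Definition transpose_maps : set End :=
  [set g : End | forall X : 'M[F]_n, g X = X^T].

(* Subgroup of GL(M_n(F)) generated by S; for sets S of bijective maps, where
   the total inverse of 'End is the actual inverse. *)
Inductive generated_subgroup (S : set End) : set End :=
| gen_incl g of S g : generated_subgroup S g
| gen_id : generated_subgroup S \1%VF
| gen_comp g h of generated_subgroup S g & generated_subgroup S h :
    generated_subgroup S (g \o h)%VF
| gen_inv g of generated_subgroup S g : generated_subgroup S (g^-1)%VF.

Definition perm_torus_transpose_group : set End :=
  generated_subgroup (diag_perm_maps `|` torus_maps `|` transpose_maps).

End MatrixGroups.

Arguments immanant_stab F n p : clear implicits.
Arguments perm_torus_transpose_group F n : clear implicits.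

(* Main.v *)
(* Let chi be the character of pi. Row-column combinatorics of the Young
   symmetrizer expresses chi by conjugation averages of its coefficients, so chi
   takes integer values; being irreducible it has norm 1, turns class sums into
   scalars and has a zero, and since pi is not symmetric it is nonzero on some
   odd permutation.

   Call an endomorphism A of the matrix space killing if the derivative of the
   immanant at X in the direction A X vanishes. Testing on matrices with few
   nonzero entries shows that killing endomorphisms are diagonal on elementary
   matrices. The stabilizer of the immanant permutes them by conjugation, so
   each g in it maps elementary matrices to multiples of elementary matrices. A
   diagonal map c in the stabilizer satisfies \prod_i c i (s i) = 1 on the
   support of chi; since the support contains enough permutations, c has the
   form a_i b_j. As g normalizes these, it permutes cells by an independent
   permutation of rows and columns, up to transposition. Finally the two
   permutations agree, because right translations preserving the support of chi
   form a normal subgroup, which cannot contain the alternating group. *)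

Require Import Defs.
From mathcomp Require Import classical_sets reals complex.
From mathcomp Require Import all_boot all_order all_algebra all_fingroup.
From mathcomp Require Import mxrepresentation.
From mathcomp Require Import cyclic gseries alt.
From mathcomp Require Import all_field classfun character integral_char.
From mathcomp Require Import ring lra zify.

Set Implicit Arguments.
Unset Strict Implicit.
Unset Printing Implicit Defensive.

Import Order.TTheory GRing.Theory Num.Theory.

(** The identity [e * e = c e] for the Young symmetrizer is the source of all facts about chi; its
    values on individual classes are never computed. The main obstacle is therefore to locate enough
    of the support, uniformly in the partition. Class sums acting as scalars supply it: they relate,
    with coefficients polynomial in n, the values of chi on classes moving at most seven points, and
    too many vanishing values would contradict the positivity, the arithmetic or the size of
    [chi 1].

    The killing endomorphisms form the Lie algebra of the stabilizer, which the stabilizer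
    normalizes by conjugation; one diagonal element of it with pairwise distinct weights suffices to
    track elementary matrices. An off-diagonal coefficient between two cells of one line would make
    the support stable under all transpositions, so that chi could not have the zero provided by
    Burnside's theorem. Similarly, the odd permutation makes the support meet both cosets of the
    alternating group, so that invariance under this group would again leave no zero. *)

(** * Counting cells of a Young diagram *)

Section Tableau.

Variables (n : nat) (p : seq nat).
Hypothesis hp : is_intpart n p.

Local Notation row k := (reshape_index p k).
Local Notation col k := (reshape_offset p k).

Let sump : sumn p = n. Proof. by case/and3P: hp => _ _ /eqP. Qed.

Lemma cell_inj (k l : 'I_n) : row k = row l -> col k = col l -> k = l.
Proof.
move=> hr hc; apply: val_inj => /=.
by rewrite -(reshape_indexK p k) -(reshape_indexK p l) hr hc.
Qed.

Lemma row_lt_size (k : 'I_n) : row k < size p.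
Proof. by apply: reshape_indexP; rewrite sump. Qed.

Lemma col_lt (k : 'I_n) : col k < nth 0 p (row k).
Proof. by apply: reshape_offsetP; rewrite sump. Qed.

Lemma cell_exists i c : c < nth 0 p i ->
  exists k : 'I_n, row k = i /\ col k = c.
Proof.
move=> hc; have lt_n : flatten_index p i c < n.
  by rewrite -[X in _ < X]sump flatten_indexP.
by exists (Ordinal lt_n); rewrite /= flatten_indexKl ?flatten_indexKr.
Qed.

(** The count is the length of column [c], a part of the conjugate partition. As the parts decrease,
    column [c] occupies an initial segment of the rows; rows past the end of [p] have length 0 by
    the default of [nth]. *)
Lemma lt_nth_count i c : (c < nth 0 p i) = (i < count (fun x => c < x) p).
Proof.
have := hp => /andP[sp _]; elim: p sp i => [|a q IHq] /= sp i.
  by rewrite nth_nil.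
have sq := path_sorted sp.
have ge_a : all (geq a) q.
  by apply: order_path_min sp => x y z; apply: rev_trans leq_trans _ _ _.
case: (ltnP c a) => [lt_ca | le_ac]; first by case: i => [|i] //=; rewrite IHq.
have c0 : count (fun x => c < x) q = 0.
  apply/eqP; rewrite -leqn0 leqNgt -has_count; apply/hasPn => x xq.
  by rewrite -leqNgt; apply: leq_trans le_ac; apply: (allP ge_a).
by rewrite c0 ltn0; case: i => [|i] /=; rewrite ?ltnNge ?le_ac // -ltnNge IHq // c0.
Qed.

Lemma card_row_col_lt i m :
  #|[set k : 'I_n | (row k == i) && (col k < m)]| = minn (nth 0 p i) m.
Proof.
have lt_n (c : 'I_(minn (nth 0 p i) m)) : flatten_index p i c < n.
  rewrite -[X in _ < X]sump flatten_indexP //.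
  by apply: leq_trans (ltn_ord c) _; rewrite geq_minl.
have lt_c (c : 'I_(minn (nth 0 p i) m)) : c < nth 0 p i.
  by apply: leq_trans (ltn_ord c) _; rewrite geq_minl.
pose h c := Ordinal (lt_n c).
have h_inj : injective h.
  move=> c d /(congr1 (fun k : 'I_n => col k)) /=.
  by rewrite !flatten_indexKr // => /val_inj.
rewrite -[RHS]card_ord -(card_imset _ h_inj); apply: eq_card => k.
rewrite !inE; apply/andP/imsetP => [[/eqP ri lt_m] | [c _ ->]].
  have lt_k : col k < minn (nth 0 p i) m by rewrite leq_min lt_m -ri col_lt.
  exists (Ordinal lt_k) => //; apply: val_inj => /=.
  by rewrite -ri reshape_indexK.
rewrite /= flatten_indexKl // flatten_indexKr // eqxx; split=> //.
by apply: leq_trans (ltn_ord c) _; rewrite geq_minr.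
Qed.

Lemma card_col_row_lt c m :
  #|[set k : 'I_n | (col k == c) && (row k < m)]|
    = minn (count (fun x => c < x) p) m.
Proof.
have lt_c (i : 'I_(minn (count (fun x => c < x) p) m)) : c < nth 0 p i.
  by rewrite lt_nth_count; apply: leq_trans (ltn_ord i) _; rewrite geq_minl.
have lt_n (i : 'I_(minn (count (fun x => c < x) p) m)) :
    flatten_index p i c < n.
  by rewrite -[X in _ < X]sump flatten_indexP.
pose h i := Ordinal (lt_n i).
have h_inj : injective h.
  move=> i j /(congr1 (fun k : 'I_n => row k)) /=.
  by rewrite !flatten_indexKl // => /val_inj.
rewrite -[RHS]card_ord -(card_imset _ h_inj); apply: eq_card => k.
rewrite !inE; apply/andP/imsetP => [[/eqP ci lt_m] | [i _ ->]].
  have lt_k : row k < minn (count (fun x => c < x) p) m.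
    by rewrite leq_min lt_m andbT -lt_nth_count -ci col_lt.
  exists (Ordinal lt_k) => //; apply: val_inj => /=.
  by rewrite -ci reshape_indexK.
rewrite /= flatten_indexKl // flatten_indexKr // eqxx; split=> //.
by apply: leq_trans (ltn_ord i) _; rewrite geq_minr.
Qed.

End Tableau.

Lemma card_fiber_lt (T : finType) (f g : T -> nat) i m :
  (forall x y, f x = i -> f y = i -> g x = g y -> x = y) ->
  #|[set x | (f x == i) && (g x < m)]| <= minn #|[set x | f x == i]| m.
Proof.
move=> inj_g; rewrite leq_min; apply/andP; split.
  by apply: subset_leq_card; apply/subsetP=> x; rewrite !inE => /andP[].
case: m => [|m].
  by rewrite (eq_card0 (A := [set _ | _])) // => x; rewrite !inE ltn0 andbF.
rewrite -[X in _ <= X]card_ord -(card_in_imset (f := fun x => inord (g x) : 'I_m.+1)).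
  exact: max_card.
move=> x y; rewrite !inE => /andP[/eqP fx gx] /andP[/eqP fy gy] /(congr1 val).
by rewrite /= !inordK //; apply: inj_g.
Qed.

Lemma card_fiber_sum (T : finType) (f : T -> nat) (P : pred T) B :
  (forall x, f x < B) ->
  #|[set x | P x]| = \sum_(i < B) #|[set x | (f x == i) && P x]|.
Proof.
move=> fB; rewrite -sum1_card.
rewrite (partition_big (fun x => Ordinal (fB x)) xpredT) //=.
apply: eq_bigr => i _; rewrite -sum1_card; apply: eq_bigl => x.
by rewrite !inE andbC.
Qed.

(** The counting behind the dominance order: on each fiber of [f] the map [g] is injective, so at
    most the minimum of the fiber size and [m] of its values are below [m], a bound that [h]
    attains. *)
Lemma card_lt_leq_fibers (T : finType) (f g h : T -> nat) B m :
  (forall x, f x < B) ->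
  (forall x y, f x = f y -> g x = g y -> x = y) ->
  (forall i, #|[set x | (f x == i) && (h x < m)]| = minn #|[set x | f x == i]| m) ->
  #|[set x | g x < m]| <= #|[set x | h x < m]|.
Proof.
move=> fB inj_g hh; rewrite (card_fiber_sum _ fB) (card_fiber_sum (fun x => h x < m) fB).
apply: leq_sum => i _; rewrite hh; apply: card_fiber_lt => x y fx fy.
by apply: inj_g; rewrite fx fy.
Qed.

(** * Row and column transversals *)

Section YoungCombinatorics.

Variables (n : nat) (p : seq nat).
Hypothesis hp : is_intpart n p.

Local Notation row k := (reshape_index p k).
Local Notation col k := (reshape_offset p k).

Lemma card_row i : #|[set k : 'I_n | row k == i]| = nth 0 p i.
Proof.
rewrite -[RHS]minnn -(card_row_col_lt hp); apply: eq_card => k.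
by rewrite !inE; case: eqP => //= <-; rewrite (col_lt hp).
Qed.

Lemma card_col c : #|[set k : 'I_n | col k == c]| = count (fun x => c < x) p.
Proof.
rewrite -[RHS]minnn -(card_col_row_lt hp); apply: eq_card => k.
by rewrite !inE; case: eqP => //= <-; rewrite -(lt_nth_count hp) (col_lt hp).
Qed.

Lemma col_lt_n (k : 'I_n) : col k < n.
Proof.
by apply: leq_ltn_trans (ltn_ord k); rewrite leq_subr.
Qed.

Lemma row_lt_n (k : 'I_n) : row k < n.
Proof.
apply: leq_trans (row_lt_size hp k) _.
have /and3P[_ p0 /eqP <-] := hp.
elim: p p0 => [|a q IHq] //=; rewrite inE negb_or => /andP[a0 /IHq].
by case: a a0 => // a _; rewrite addSn ltnS => /leq_trans -> //; rewrite leq_addl.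
Qed.

(* [g] maps each row to a transversal of the columns; comparing, for every [m],
   how many cells land in the first [m] columns shows that it maps row [i] into
   the columns that actually meet row [i]. *)
Lemma col_perm_lt (g : 'S_n) :
  (forall k l : 'I_n, row k = row l -> col (g k) = col (g l) -> k = l) ->
  forall k : 'I_n, col (g k) < nth 0 p (row k).
Proof.
move=> inj_g k; set i := row k; set m := nth 0 p i.
have le_all j : #|[set l : 'I_n | (row l == j) && (col (g l) < m)]|
    <= #|[set l : 'I_n | (row l == j) && (col l < m)]|.
  rewrite (card_row_col_lt hp) -card_row.
  apply: (@card_fiber_lt _ (fun l : 'I_n => row l) (fun l => col (g l))) => x y rx ry.
  by apply: inj_g; rewrite rx ry.
have eq_tot : #|[set l : 'I_n | col (g l) < m]| = #|[set l : 'I_n | col l < m]|.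
  rewrite -(card_imset _ (@perm_inj _ g)); apply: eq_card => l.
  rewrite inE; apply/imsetP/idP => [[x + ->] | lm]; first by rewrite inE.
  by exists (g^-1 l)%g; rewrite ?inE permKV.
have/eqP := eq_tot.
rewrite (card_fiber_sum (fun l : 'I_n => col (g l) < m) row_lt_n).
rewrite (card_fiber_sum (fun l : 'I_n => col l < m) row_lt_n).
rewrite (leqif_sum (fun (j : 'I_n) _ => leqif_eq (le_all j))) => /forallP /(_ (Ordinal (row_lt_n k))) /=.
rewrite (card_row_col_lt hp) minnn -card_row => /eqP eq_k.
have : [set l : 'I_n | (row l == i) && (col (g l) < m)] = [set l : 'I_n | row l == i].
  apply/eqP; rewrite eqEcard -eq_k leqnn andbT.
  by apply/subsetP => l; rewrite !inE => /andP[].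
by move/setP/(_ k); rewrite !inE eqxx /=.
Qed.

(** As the left factor acts first, [r] has to send [k] to the cell in the row of [k] and the column
    of [g k]; [col_perm_lt] says that this cell lies in the diagram. *)
Lemma row_col_decomposition (g : 'S_n) :
  (forall k l : 'I_n, row k = row l -> col (g k) = col (g l) -> k = l) ->
  exists r q : 'S_n, [/\ r \in row_stab n p, q \in col_stab n p & g = (r * q)%g].
Proof.
move=> inj_g; have lt_c := col_perm_lt inj_g.
have ex_r (k : 'I_n) : exists l : 'I_n, (row l == row k) && (col l == col (g k)).
  by have [l [rl cl]] := cell_exists hp (lt_c k); exists l; rewrite rl cl !eqxx.
pose r k := xchoose (ex_r k).
have rP k : row (r k) = row k /\ col (r k) = col (g k).
  by have /andP[/eqP ? /eqP ?] := xchooseP (ex_r k).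
have r_inj : injective r.
  move=> k l e; have [rk ck] := rP k; have [rl cl] := rP l.
  by apply: inj_g; rewrite -?rk -?rl -?ck -?cl e.
exists (perm r_inj), ((perm r_inj)^-1 * g)%g; split.
- by rewrite inE; apply/forallP => k; rewrite permE; have [-> _] := rP k.
- rewrite inE; apply/forallP => k; rewrite permM.
  have [_ <-] := rP ((perm r_inj)^-1 k)%g.
  by rewrite -[r _](permE r_inj) permKV.
- by rewrite mulKVg.
Qed.

(** The condition on rows bounds every partial sum of [p] by that of its conjugate, and the
    condition on columns gives the reverse bound. Equal partial sums have equal differences, the
    parts. *)
Lemma conj_intpart_of_transversal (g : 'S_n) :
  (forall k l : 'I_n, row k = row l -> row (g k) = row (g l) -> k = l) ->
  (forall k l : 'I_n, col k = col l -> col (g k) = col (g l) -> k = l) ->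
  p = conj_intpart p.
Proof.
move=> inj_r inj_c.
have move_g (f : 'I_n -> nat) m :
    #|[set l : 'I_n | f (g l) < m]| = #|[set l : 'I_n | f l < m]|.
  rewrite -(card_imset _ (@perm_inj _ g)); apply: eq_card => l.
  rewrite inE; apply/imsetP/idP => [[x + ->] | lm]; first by rewrite inE.
  by exists (g^-1 l)%g; rewrite ?inE permKV.
have eq_lt m : #|[set k : 'I_n | row k < m]| = #|[set k : 'I_n | col k < m]|.
  apply/eqP; rewrite eqn_leq; apply/andP; split.
    rewrite -(move_g (fun k => row k)).
    apply: card_lt_leq_fibers row_lt_n inj_r _ => i.
    by rewrite (card_row_col_lt hp) card_row.
  rewrite -(move_g (fun k => col k)).
  apply: card_lt_leq_fibers col_lt_n inj_c _ => i.
  by rewrite (card_col_row_lt hp) card_col.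
have split_lt (f : 'I_n -> nat) m : #|[set k : 'I_n | f k < m.+1]|
    = #|[set k | f k < m]| + #|[set k | f k == m]|.
  rewrite -!sum1dep_card (bigID (fun k => f k < m)) /=; congr (_ + _);
    apply: eq_bigl => k; rewrite -?leqNgt ltnS.
    by rewrite andb_idl // => /ltnW.
  by rewrite eqn_leq.
have eq_i i : nth 0 p i = count (fun x => i < x) p.
  rewrite -card_row -card_col; apply/(@addnI #|[set k : 'I_n | row k < i]|).
  by rewrite -split_lt eq_lt split_lt -eq_lt.
have /and3P[_ p0 _] := hp.
have head_count : head 0 p = size p.
  rewrite -nth0 eq_i; apply/eqP; rewrite -all_count; apply/allP => x xp.
  by rewrite lt0n; apply: contraNneq p0 => <-.
apply: (@eq_from_nth _ 0); first by rewrite size_mkseq head_count.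
by move=> i lt_i; rewrite nth_mkseq ?head_count.
Qed.

Lemma exists_row_pair :
  p <> nseq n 1 -> exists k l : 'I_n, k != l /\ row k = row l.
Proof.
move=> hcol; have /and3P[_ p0 /eqP sump] := hp.
have [all1|/allPn[x xp]] := boolP (all (fun x => x <= 1) p).
  case: hcol; rewrite -sump; elim: p p0 all1 => //= a q IHq.
  rewrite inE negb_or => /andP[a0 /IHq e] /andP[a1 /e eq].
  by case: a a0 a1 => [|[]] //= _ _; rewrite -eq.
rewrite -ltnNge => lt1; pose i := index x p.
have xi : x = nth 0 p i by rewrite nth_index.
have [k [rk ck]] := @cell_exists _ _ hp i 0 (leq_trans (ltn0Sn 1) (leq_trans lt1 (eq_leq xi))).
have [l [rl cl]] := @cell_exists _ _ hp i 1 (leq_trans lt1 (eq_leq xi)).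
by exists k, l; split; [apply/eqP => e; rewrite e cl in ck | rewrite rk rl].
Qed.

Lemma exists_col_pair :
  0 < n -> p <> [:: n] -> exists k l : 'I_n, k != l /\ col k = col l.
Proof.
move=> n_gt0 hrow; have /and3P[_ p0 /eqP sump] := hp.
have [a [b [q def_p]]] : exists a b q, p = [:: a, b & q].
  case: p sump hrow => [sum0|a [|b q]]; last by exists a, b, q.
    by rewrite -sum0 in n_gt0.
  by rewrite /= addn0 => ->.
have [a0 b0] : 0 < a /\ 0 < b.
  by move: p0; rewrite def_p !inE !negb_or !lt0n ![0 == _]eq_sym => /and3P[].
have [k [rk ck]] : exists k : 'I_n, row k = 0 /\ col k = 0.
  by apply: (cell_exists hp); rewrite def_p.
have [l [rl cl]] : exists k : 'I_n, row k = 1 /\ col k = 0.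
  by apply: (cell_exists hp); rewrite def_p.
by exists k, l; split; [apply/eqP => e; rewrite e rl in rk | rewrite ck cl].
Qed.

End YoungCombinatorics.

Local Open Scope ring_scope.

(** * Coefficients of the Young symmetrizer and their conjugation averages *)

Definition young_coef (n : nat) (p : seq nat) (s : 'S_n) : int :=
  \sum_(r in row_stab n p) \sum_(q in col_stab n p) (-1) ^+ q * (r * q == s)%g%:R.

Section YoungCoef.

Variables (n : nat) (p : seq nat).
Hypothesis hp : is_intpart n p.

Local Notation row k := (reshape_index p k).
Local Notation col k := (reshape_offset p k).
Local Notation R := (row_stab n p).
Local Notation C := (col_stab n p).
Local Notation e := (@young_coef n p).

Lemma row_stabP (s : 'S_n) : reflect (forall k, row (s k) = row k) (s \in R).
Proof. by rewrite inE; apply: (iffP forallP) => h k; apply/eqP. Qed.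

Lemma col_stabP (s : 'S_n) : reflect (forall k, col (s k) = col k) (s \in C).
Proof. by rewrite inE; apply: (iffP forallP) => h k; apply/eqP. Qed.

Lemma row_stab_group_set : group_set R.
Proof.
apply/group_setP; split; first by apply/row_stabP => k; rewrite perm1.
move=> s t /row_stabP hs /row_stabP ht.
by apply/row_stabP => k; rewrite permM ht hs.
Qed.
Canonical row_stab_group := Group row_stab_group_set.

Lemma col_stab_group_set : group_set C.
Proof.
apply/group_setP; split; first by apply/col_stabP => k; rewrite perm1.
move=> s t /col_stabP hs /col_stabP ht.
by apply/col_stabP => k; rewrite permM ht hs.
Qed.
Canonical col_stab_group := Group col_stab_group_set.

Lemma row_col_stab_trivial (s : 'S_n) : s \in R -> s \in C -> s = 1%g.
Proof.
move=> /row_stabP hr /col_stabP hc; apply/permP => k; rewrite perm1.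
exact: cell_inj (hr k) (hc k).
Qed.

Lemma tperm_row_stab (k l : 'I_n) : (tperm k l \in R) = (row k == row l).
Proof.
apply/row_stabP/eqP => [/(_ l)|e x]; first by rewrite tpermR.
by case: tpermP => [->|->|].
Qed.

Lemma tperm_col_stab (k l : 'I_n) : (tperm k l \in C) = (col k == col l).
Proof.
apply/col_stabP/eqP => [/(_ l)|e x]; first by rewrite tpermR.
by case: tpermP => [->|->|].
Qed.

Lemma young_coef_mull (r s : 'S_n) : r \in R -> e (r * s)%g = e s.
Proof.
move=> rR; rewrite /young_coef (reindex_inj (mulgI r)) /=.
apply: eq_big => [x|x _]; first by rewrite groupMl.
by apply: eq_bigr => q _; rewrite -mulgA (inj_eq (mulgI r)).
Qed.

Lemma young_coef_mulr (q s : 'S_n) : q \in C -> e (s * q)%g = (-1) ^+ q * e s.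
Proof.
move=> qC; rewrite /young_coef mulr_sumr; apply: eq_bigr => r _.
rewrite (reindex_inj (mulIg q)) /= mulr_sumr.
apply: eq_big => [x|x _]; first by rewrite groupMr.
by rewrite mulgA (inj_eq (mulIg q)) odd_permM addbC signr_addb mulrA.
Qed.

Lemma young_coef_tpermL (k l : 'I_n) s : row k == row l -> e (tperm k l * s)%g = e s.
Proof. by rewrite -tperm_row_stab; apply: young_coef_mull. Qed.

Lemma young_coef_tpermR (k l : 'I_n) s :
  col k == col l -> e (s * tperm k l)%g = (-1) ^+ (k != l) * e s.
Proof. by rewrite -tperm_col_stab => /young_coef_mulr->; rewrite odd_tperm. Qed.

Lemma young_coef1 : e 1%g = 1.
Proof.
rewrite /young_coef (bigD1 1%g) ?group1 //= (bigD1 1%g) ?group1 //=.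
rewrite odd_perm1 mulg1 eqxx mulr1 !big1 ?addr0 // => [r /andP[rR r1]|q /andP[_ q1]].
  rewrite big1 // => q qC; case: eqP => [rq|]; last by rewrite mulr0.
  case/eqP: r1; apply: row_col_stab_trivial => //.
  by rewrite -(groupMr _ qC) rq group1.
by rewrite mul1g (negbTE q1) mulr0.
Qed.

(** Either [g] is a row permutation times a column permutation, and equivariance determines [y g]
    from [y 1]; or two cells of one row go to one column, and their transposition, moved from the
    left to the right of [g], gives [y g = - y g]. *)
Lemma young_coef_unique (y : 'S_n -> int) :
  (forall r s, r \in R -> y (r * s)%g = y s) ->
  (forall q s, q \in C -> y (s * q)%g = (-1) ^+ q * y s) ->
  forall s, y s = y 1%g * e s.
Proof.
move=> yR yC g.
have [/forallP ok|] := boolP [forall k : 'I_n, forall l : 'I_n,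
   (row k == row l) && (col (g k) == col (g l)) ==> (k == l)].
  have [|r [q [rR qC ->]]] := @row_col_decomposition _ _ hp g.
    move=> k l rkl ckl; have /forallP/(_ l)/implyP := ok k.
    by rewrite rkl ckl !eqxx => /(_ isT)/eqP.
  rewrite yR // -{1}[q]mul1g yC // young_coef_mull // -[in e q](mul1g q).
  by rewrite young_coef_mulr // young_coef1 mulr1 mulrC.
rewrite negb_forall => /existsP[k]; rewrite negb_forall => /existsP[l].
rewrite negb_imply => /andP[/andP[rkl ckl] nkl].
have odd0 (z : 'S_n -> int) : (forall r s, r \in R -> z (r * s)%g = z s) ->
    (forall q s, q \in C -> z (s * q)%g = (-1) ^+ q * z s) -> z g = 0.
  move=> zR zC; have : z g = - z g.
    rewrite -{1}(zR (tperm k l)) ?tperm_row_stab // conjgC tpermJ zC ?tperm_col_stab //.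
    by rewrite odd_tperm (inj_eq perm_inj) nkl expr1 mulN1r.
  by move/eqP; rewrite -addr_eq0 -mulr2n mulrn_eq0 => /eqP.
rewrite odd0 // (odd0 e) ?mulr0 //; first exact: young_coef_mull.
exact: young_coef_mulr.
Qed.

(** The scalar in [e * e = c e], that is n! divided by the degree of the character. *)
Definition young_norm : int := \sum_u e u * e (u^-1)%g.
Local Notation c := young_norm.

(** The left side is the coefficient of [e g e] at [s]. This product inherits both equivariances of
    [e], so it is a multiple of [e]; the factor is its coefficient at 1, which after cyclic rotation
    is the coefficient of [e e] at the inverse of [g]. *)
Lemma young_coef_conv (g s : 'S_n) :
  \sum_u e u * e (g^-1 * u^-1 * s)%g = c * e (g^-1)%g * e s.
Proof.
pose y h x := \sum_u e u * e (h^-1 * u^-1 * x)%g.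
have y1 h x : y h x = y h 1%g * e x.
  apply: (young_coef_unique (y := y h)) => [r t rR|q t qC].
    rewrite /y (reindex_inj (mulgI r)) /=; apply: eq_bigr => u _.
    by rewrite young_coef_mull // invMg !mulgA mulgKV.
  by rewrite /y mulr_sumr; apply: eq_bigr => u _; rewrite mulgA young_coef_mulr // mulrCA.
have cE : y 1%g 1%g = c.
  by apply: eq_bigr => u _; rewrite invg1 mul1g mulg1.
rewrite -/(y g s) y1; congr (_ * _); rewrite -cE -y1 /y.
rewrite [RHS](reindex_inj invg_inj) /= [RHS](reindex_inj (mulIg g)) /=.
apply: eq_bigr => u _.
by rewrite invg1 mul1g mulg1 invgK mulgK invMg mulrC.
Qed.

Lemma young_coef_conv1 s : \sum_u e u * e (u^-1 * s)%g = c * e s.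
Proof.
rewrite -[RHS]mul1r -young_coef1 mulrCA mulrA -invg1 -young_coef_conv.
by apply: eq_bigr => u _; rewrite invg1 mul1g.
Qed.

(* [#|R|^2 c] is the sum of squares of the coefficients of [a b a], where [a]
   and [b] are the row symmetrizer and the column antisymmetrizer. *)
Lemma young_norm_gt0 : 0 < c.
Proof.
pose x s := \sum_(r in R) e (s * r)%g.
have xV s : x (s^-1)%g = x s.
  rewrite /x /young_coef exchange_big /=.
  apply: eq_bigr => r rR; apply: eq_bigr => t tR.
  rewrite (reindex_inj invg_inj) /=; apply: eq_big => [q|q qC]; first by rewrite groupV.
  rewrite odd_permV; congr (_ * (nat_of_bool _)%:R).
  by rewrite -(inj_eq (mulgI s)) mulKVg mulgA -(inj_eq (mulIg q)) mulgKV eq_sym.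
have x1 : x 1%g = #|R|%:R.
  rewrite /x -sumr_const; apply: eq_bigr => r rR.
  by rewrite mul1g -[r]mulg1 young_coef_mull // young_coef1.
have xx : \sum_s x s * x (s^-1)%g = #|R|%:R ^+ 2 * c.
  rewrite expr2 -mulrA -{2}x1 /x mulr_suml.
  under eq_bigr => s _.
    rewrite mulr_suml; under eq_bigr => r _ do rewrite mulr_sumr.
    over.
  rewrite exchange_big mulr_natl -sumr_const /=; apply: eq_bigr => r rR.
  rewrite exchange_big; apply: eq_bigr => t tR.
  rewrite mul1g mulrC -young_coef_conv1 (reindex_inj (mulIg (r^-1)%g)) /=.
  apply: eq_bigr => u _; rewrite mulgKV invMg invgK.
  by rewrite -!mulgA young_coef_mull.
have R_gt0 : 0 < #|R|%:R :> int by rewrite ltr0n cardG_gt0.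
rewrite -(pmulr_rgt0 _ (exprn_gt0 2 R_gt0)) -xx (bigD1 1%g) //= invg1 x1.
rewrite ltr_wpDr ?mulr_gt0 // sumr_ge0 // => s _.
by rewrite xV -expr2 sqr_ge0.
Qed.

(** This is [c] times the character of the Specht module, as [specht_charE] and [young_avgV] will
    show. *)
Definition young_avg (s : 'S_n) : int := \sum_(g : 'S_n) e (s ^ g)%g.
Local Notation N := young_avg.

Lemma young_avgJ s h : N (s ^ h)%g = N s.
Proof.
rewrite /N [RHS](reindex_inj (mulgI h)) /=.
by apply: eq_bigr => g _; rewrite conjgM.
Qed.

Lemma young_avg1 : N 1%g = #|'S_n|%:R.
Proof.
rewrite /N -sumr_const; apply: eq_bigr => g _.
by rewrite conj1g young_coef1.
Qed.

Lemma young_avg_coef : \sum_s N s * e (s^-1)%g = c ^+ 2.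
Proof.
rewrite /N; under eq_bigr => s _ do rewrite mulr_suml.
rewrite exchange_big /= expr2 {2}/young_norm mulr_sumr.
apply: eq_bigr => h _; have := young_coef_conv (h^-1) (h^-1); rewrite invgK -mulrA => <-.
rewrite (reindex_inj (conjg_inj (h^-1)%g)) /=.
by apply: eq_bigr => u _; rewrite conjgKV -conjVg /conjg invgK !mulgA.
Qed.

(** After division by [c ^ 2] this says that the character has norm 1; irreducibility is deduced
    from it. *)
Lemma young_avg_norm : \sum_s N s * N (s^-1)%g = #|'S_n|%:R * c ^+ 2.
Proof.
rewrite -young_avg_coef mulr_natl -sumr_const.
rewrite {2}/N; under eq_bigr => s _ do rewrite mulr_sumr.
rewrite exchange_big; apply: eq_bigr => h _.
rewrite (reindex_inj (conjg_inj (h^-1)%g)) /=.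
by apply: eq_bigr => u _; rewrite young_avgJ conjVg conjgKV.
Qed.

(* The sum of an equivariant family is a central element of the group algebra;
   it therefore multiplies the Young symmetrizer by a scalar. *)
Lemma young_avg_central (J : finType) (P : pred J) (w : J -> 'S_n)
    (act : 'S_n -> J -> J) :
  (forall r, injective (act r)) -> (forall r t, P (act r t) = P t) ->
  (forall r t, P t -> w (act r t) = (w t ^ r)%g) ->
  forall s, (\sum_(t | P t) N (w t * s)%g) * N 1%g = (\sum_(t | P t) N (w t)) * N s.
Proof.
move=> inj_a Pa wa s; pose z s := \sum_(t | P t) e (w t * s)%g.
have zE x : z x = z 1%g * e x.
  apply: (young_coef_unique (y := z)) => [r y rR|q y qC].
    rewrite /z (reindex_inj (inj_a (r^-1)%g)) /=.
    apply: eq_big => [t|t]; rewrite Pa // => Pt.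
    rewrite wa // conjgE invgK -!mulgA mulKg.
    exact: young_coef_mull.
  rewrite /z mulr_sumr; apply: eq_bigr => t _; rewrite mulgA.
  exact: young_coef_mulr.
have avgE x : \sum_(t | P t) N (w t * x)%g = z 1%g * N x.
  rewrite /N mulr_sumr exchange_big; apply: eq_bigr => g _.
  rewrite -zE /z [RHS](reindex_inj (inj_a g)) /=.
  by apply: eq_big => [t|t Pt]; rewrite ?Pa // wa // conjMg.
have := avgE 1%g; under eq_bigr => t _ do rewrite mulg1.
by move=> ->; rewrite avgE mulrAC.
Qed.

(* If the character vanished on odd permutations, [young_avg_coef] would
   produce [g] with [\sum_u sgn u * e (u ^ g) * e u <> 0]; a transposition in
   [R :&: R ^ g] or in [C :&: C ^ g] would change the sign of this sum. *)
Lemma young_avg_odd : (forall s, N (s^-1)%g = N s) -> p <> conj_intpart p ->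
  exists2 s : 'S_n, odd_perm s & N s != 0.
Proof.
move=> NV hsym; apply/exists_inP; apply: contraT.
rewrite negb_exists_in => /forall_inP no_odd.
have NS s : N s = (-1) ^+ s * N s.
  case: (boolP (odd_perm s)) => os; rewrite ?expr0 ?mul1r //.
  by have := no_odd s os; rewrite negbK => /eqP ->; rewrite mulr0.
have : \sum_(g : 'S_n) \sum_(u : 'S_n) (-1) ^+ u * e (u ^ g)%g * e u != 0.
  have : c ^+ 2 != 0 by rewrite expf_neq0 // gt_eqF // young_norm_gt0.
  apply: contra_neq => s0; rewrite -young_avg_coef -[RHS]s0 (reindex_inj invg_inj).
  rewrite exchange_big; apply: eq_bigr => u _.
  rewrite NV invgK NS /young_avg.
  rewrite -mulrA mulr_suml mulr_sumr; apply: eq_bigr => g _.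
  by rewrite mulrA.
case/eqP; apply: big1 => g _.
have odd0 (f : 'S_n -> 'S_n) : injective f ->
   (forall u, (-1) ^+ (f u) * e (f u ^ g)%g * e (f u)
      = - ((-1) ^+ u * e (u ^ g)%g * e u)) ->
   \sum_(u : 'S_n) (-1) ^+ u * e (u ^ g)%g * e u = 0.
  move=> f_inj fE; set S := \sum_u _; have : S = - S.
    rewrite {1}/S (reindex_inj f_inj) /= /S -sumrN.
    by apply: eq_bigr => u _; apply: fE.
  by move/eqP; rewrite -addr_eq0 -mulr2n mulrn_eq0 => /eqP.
have [/forallP okr|] := boolP [forall k : 'I_n, forall l : 'I_n,
   (row k == row l) && (row (g k) == row (g l)) ==> (k == l)]; last first.
  rewrite negb_forall => /existsP[k]; rewrite negb_forall => /existsP[l].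
  rewrite negb_imply => /andP[/andP[rkl gkl] nkl].
  apply: (odd0 (mulg (tperm k l))) => [|u]; first exact: mulgI.
  rewrite odd_permM odd_tperm nkl addTb signrN conjMg tpermJ.
  by rewrite !young_coef_tpermL // !mulNr.
have [/forallP okc|] := boolP [forall k : 'I_n, forall l : 'I_n,
   (col k == col l) && (col (g k) == col (g l)) ==> (k == l)]; last first.
  rewrite negb_forall => /existsP[k]; rewrite negb_forall => /existsP[l].
  rewrite negb_imply => /andP[/andP[ckl gkl] nkl].
  apply: (odd0 (mulg^~ (tperm k l))) => [|u]; first exact: mulIg.
  rewrite odd_permM odd_tperm nkl addbT signrN conjMg tpermJ.
  rewrite !young_coef_tpermR // (inj_eq perm_inj) nkl.
  by rewrite expr1 !mulN1r !mulrN !mulNr opprK.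
case: hsym; apply: (@conj_intpart_of_transversal _ _ hp g) => k l e1 e2; apply/eqP.
  by have /forallP/(_ l) := okr k; rewrite e1 e2 !eqxx.
by have /forallP/(_ l) := okc k; rewrite e1 e2 !eqxx.
Qed.

End YoungCoef.

(** * The character of the Specht module *)

(** Here [L] is a projection onto [U], and a trace over [U] becomes a trace over the whole space,
    where the basis of group elements is available. *)
Lemma mxtrace_submod (F : fieldType) (gT : finGroupType) (G : {group gT}) m
    (rG : mx_representation F G m) (U : 'M[F]_m) (modU : mxmodule rG U)
    (L : 'M[F]_m) :
  (L <= U)%MS -> U *m L = U ->
  forall x, x \in G -> \tr (submod_repr modU x) = \tr (L *m rG x).
Proof.
move=> sLU UL x Gx.
pose b : 'M_(\rank U, m) := val_submod 1%:M; pose w : 'M_(m, \rank U) := in_submod U L.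
have wb : w *m b = L by rewrite -val_submodE in_submodK.
have bL : b *m L = b.
  have : (b <= U)%MS by apply: val_submodP.
  by case/submxP=> D ->; rewrite -mulmxA UL.
have bw : b *m w = 1%:M.
  by rewrite /w in_submodE mulmxA -in_submodE bL val_submodK.
have Ab : submod_repr modU x *m b = b *m rG x.
  by rewrite -val_submodE -val_submodJ // mul1mx.
by rewrite -[X in \tr X]mulmx1 -bw mulmxA Ab mxtrace_mulC mulmxA wb.
Qed.

Section SpechtChar.

Variables (F : numFieldType) (n : nat) (p : seq nat).
Hypothesis hp : is_intpart n p.

Local Notation G := [set: 'S_n]%G.
Local Notation aG := (regular_repr F G).
Local Notation e := (@young_coef n p).
Local Notation c := (@young_norm n p).

Lemma young_symmetrizerE :
  young_symmetrizer F n p = \sum_(s : 'S_n) (e s)%:~R *: aG s.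
Proof.
rewrite /young_symmetrizer mulmx_suml.
under [RHS]eq_bigr => s _.
  rewrite /young_coef raddf_sum scaler_suml.
  under eq_bigr => r _ do rewrite raddf_sum scaler_suml.
  over.
rewrite exchange_big; apply: eq_bigr => r _.
rewrite mulmx_sumr exchange_big; apply: eq_bigr => q _.
rewrite (bigD1 (r * q)%g) //= eqxx mulr1 big1 ?addr0 => [|s]; last first.
  by rewrite eq_sym => /negbTE ->; rewrite mulr0 scale0r.
by rewrite -scalemxAr repr_mxM ?inE // rmorph_sign.
Qed.

Lemma regular_repr_coef (s : 'S_n) i j :
  aG s i j = (enum_val j == enum_val i * s)%g%:R.
Proof.
rewrite /= /regular_mx !mxE eqxx /=.
congr (nat_of_bool _)%:R; apply/eqP/eqP => [->|<-]; last by rewrite gring_valK.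
by rewrite gring_indexK ?inE.
Qed.

Lemma gring_row_young i :
  gring_row (young_symmetrizer F n p) 0 i = (e (enum_val i))%:~R.
Proof.
rewrite young_symmetrizerE linear_sum summxE (bigD1 (enum_val i)) //=.
rewrite mxE mxE regular_repr_coef gring_indexK ?inE // mul1g eqxx mulr1.
rewrite big1 ?addr0 // => s; rewrite eq_sym => /negbTE ns.
by rewrite mxE mxE regular_repr_coef gring_indexK ?inE // mul1g ns mulr0.
Qed.

(* The matrix of the projection [x |-> c^-1 e x] of the group algebra onto the
   Specht module. *)
Definition specht_proj : 'M[F]_#|G| :=
  \matrix_(i, j) ((e (enum_val j * (enum_val i)^-1)%g)%:~R / c%:~R).

Lemma sum_enum_val (f : 'S_n -> F) : \sum_(i < #|G|) f (enum_val i) = \sum_s f s.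
Proof.
rewrite -(big_enum_val f); by apply: eq_bigl => s; rewrite inE.
Qed.

Lemma specht_proj_comm (s : 'S_n) : specht_proj *m aG s = aG s *m specht_proj.
Proof.
apply/matrixP=> i j; rewrite [LHS]mxE [RHS]mxE.
under eq_bigr => k _ do rewrite mxE regular_repr_coef.
under [RHS]eq_bigr => k _ do rewrite regular_repr_coef mxE.
pose x := enum_val i; pose y := enum_val j.
rewrite (sum_enum_val (fun k => (e (k * x^-1)%g)%:~R / c%:~R * (y == k * s)%g%:R)).
rewrite (sum_enum_val (fun k => (k == x * s)%g%:R * ((e (y * k^-1)%g)%:~R / c%:~R))).
rewrite (bigD1 (y * s^-1)%g) //= mulgKV eqxx mulr1 big1 ?addr0 => [|k nk]; last first.
  by rewrite -(inj_eq (mulIg (s^-1)%g)) mulgK eq_sym (negbTE nk) mulr0.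
rewrite (bigD1 (x * s)%g) //= eqxx mul1r big1 ?addr0 => [|k /negbTE->]; last first.
  by rewrite mul0r.
by rewrite invMg mulgA.
Qed.

Lemma young_norm_neq0 : c%:~R != 0 :> F.
Proof. by rewrite intr_eq0 gt_eqF ?young_norm_gt0. Qed.

Lemma young_row_proj :
  gring_row (young_symmetrizer F n p) *m specht_proj
    = gring_row (young_symmetrizer F n p).
Proof.
apply/rowP => j; rewrite gring_row_young !mxE.
under eq_bigr => k _ do rewrite gring_row_young mxE.
pose y := enum_val j; rewrite -/y.
rewrite (sum_enum_val (fun k => (e k)%:~R * ((e (y * k^-1)%g)%:~R / c%:~R))).
apply: (mulIf young_norm_neq0); rewrite mulr_suml -intrM mulrC -young_coef_conv1 //.
rewrite [RHS]raddf_sum [RHS](reindex_inj invg_inj) /=.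
rewrite [RHS](reindex_inj (mulIg (y^-1)%g)) /=; apply: eq_bigr => k _.
by rewrite -mulrA divfK ?young_norm_neq0 // invgK mulgKV invMg invgK intrM mulrC.
Qed.

Local Notation U := (specht_mx F n p).

Lemma specht_mx_proj : U *m specht_proj = U.
Proof.
apply/row_matrixP => i; rewrite row_mul.
have/cyclic_mxP[A /envelop_mxP[a ->] ->] : (row i U <= U)%MS := row_sub i U.
rewrite mulmx_sumr mulmx_suml; apply: eq_bigr => s _.
by rewrite -scalemxAr -scalemxAl -mulmxA -specht_proj_comm mulmxA young_row_proj.
Qed.

Lemma specht_proj_sub : (specht_proj <= U)%MS.
Proof.
apply/row_subP => i; apply/cyclic_mxP.
exists (c%:~R^-1 *: aG (enum_val i)); first by rewrite linearZ scalemx_sub ?envelop_mx_id ?inE.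
apply/rowP => j; rewrite -scalemxAr !mxE.
under eq_bigr => k _ do rewrite gring_row_young regular_repr_coef.
pose x := enum_val i; pose y := enum_val j; rewrite -/y -/x.
rewrite (sum_enum_val (fun k => (e k)%:~R * (y == k * x)%g%:R)).
rewrite (bigD1 (y * x^-1)%g) //= mulgKV eqxx mulr1 big1 ?addr0 => [|k nk]; last first.
  by rewrite -(inj_eq (mulIg (x^-1)%g)) mulgK eq_sym (negbTE nk) mulr0.
by rewrite mulrC.
Qed.

(** The trace of [x |-> c^-1 e x s] on the group algebra: its diagonal entry at [x] is
    [e (x * s^-1 * x^-1) / c]. *)
Lemma specht_charE (s : 'S_n) : specht_char F p s = (young_avg p (s^-1)%g)%:~R / c%:~R.
Proof.
rewrite /specht_char (mxtrace_submod _ specht_proj_sub specht_mx_proj) ?inE //.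
rewrite /mxtrace; under eq_bigr => i _ do rewrite mxE.
under eq_bigr => i _ do under eq_bigr => j _ do rewrite mxE regular_repr_coef.
under eq_bigr => i _.
  rewrite (sum_enum_val (fun k => (e (k * (enum_val i)^-1)%g)%:~R / c%:~R
                                  * (enum_val i == k * s)%g%:R)).
  over.
rewrite (sum_enum_val (fun x => \sum_k (e (k * x^-1)%g)%:~R / c%:~R
                                  * (x == k * s)%g%:R)).
have -> : (young_avg p (s^-1)%g)%:~R = \sum_g (e ((s^-1) ^ g)%g)%:~R :> F.
  by rewrite /young_avg raddf_sum.
rewrite mulr_suml exchange_big /=.
rewrite [RHS](reindex_inj invg_inj) /=; apply: eq_bigr => k _.
rewrite (bigD1 (k * s)%g) //= eqxx mulr1 big1 ?addr0 => [|x /negbTE->]; last first.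
  by rewrite mulr0.
by rewrite conjgE invgK invMg mulgA.
Qed.

End SpechtChar.

Lemma exists_perm_map (T : finType) (s1 s2 : seq T) :
  uniq s1 -> uniq s2 -> size s1 = size s2 -> exists g : {perm T}, map g s1 = s2.
Proof.
elim: s1 s2 => [|x s1 IHs] [|y s2] //=; first by exists 1%g.
move=> /andP[xs1 u1] /andP[ys2 u2] [eq_size].
have [g gs] := IHs s2 u1 u2 eq_size.
exists (g * tperm (g x) y)%g; rewrite permM tpermL; congr (_ :: _).
rewrite -[RHS]gs; apply/eq_in_map => z zs; rewrite permM tpermD //.
  by apply: contraNneq xs1 => /perm_inj ->.
by apply: contraNneq ys2 => ->; rewrite -gs map_f.
Qed.

(** * Integrality, irreducibility and degree of the character *)

(** The division is exact by [specht_val_mulr]. An integer-valued character can be studied over the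
    algebraic numbers and then used over any field of characteristic 0. *)
Definition specht_val (n : nat) (p : seq nat) (s : 'S_n) : int :=
  (young_avg p s %/ young_norm n p)%Z.

Section SpechtVal.

Variables (n : nat) (p : seq nat).
Hypothesis hp : is_intpart n p.

Local Notation G := [set: 'S_n]%G.
Local Notation N := (@young_avg n p).
Local Notation c := (@young_norm n p).
Local Notation chi := (@specht_val n p).

Let phi : 'CF(G) := cfRepr (specht_repr algC n p).

Let phiE s : phi s = (N (s^-1)%g)%:~R / c%:~R.
Proof. by rewrite /phi cfunE inE mulr1n -specht_charE. Qed.

Let phi_char : phi \is a character. Proof. exact: cfRepr_char. Qed.

Let c_neq0 : c%:~R != 0 :> algC. Proof. exact: young_norm_neq0. Qed.

Let phi_rat s : phi s \in Crat.
Proof. by rewrite phiE rpred_div ?rpred_int. Qed.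

(** Character values here are rational, hence real, while complex conjugation inverts the
    argument. *)
Lemma young_avgV s : N (s^-1)%g = N s.
Proof.
have := char_inv s phi_char; rewrite (CrealP (Creal_Crat (phi_rat s))).
rewrite !phiE invgK => /(mulIf (invr_neq0 c_neq0)) /eqP.
by rewrite eqr_int => /eqP.
Qed.

Let phiE' s : phi s = (N s)%:~R / c%:~R.
Proof. by rewrite phiE young_avgV. Qed.

Let phi_int s : phi s \is a Num.int.
Proof. exact: Cint_rat_Aint (phi_rat s) (Aint_char s phi_char). Qed.

Let chiE s : phi s = (chi s)%:~R.
Proof.
have /intrP[m phi_m] := phi_int s; rewrite phi_m.
have : (N s)%:~R = (m * c)%:~R :> algC by rewrite intrM -phi_m phiE' divfK.
move/eqP; rewrite eqr_int => /eqP Ns; rewrite /specht_val Ns mulzK //.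
by rewrite gt_eqF // young_norm_gt0.
Qed.

Lemma specht_val_mulr s : chi s * c = N s.
Proof.
by apply/eqP; rewrite -(eqr_int algC) intrM -chiE phiE' divfK.
Qed.

Lemma specht_char_val (F : numFieldType) s : specht_char F p s = (chi s)%:~R.
Proof.
rewrite specht_charE // young_avgV -specht_val_mulr intrM mulfK //.
by apply: young_norm_neq0.
Qed.

Lemma specht_valJ s h : chi (s ^ h)%g = chi s.
Proof. by rewrite /specht_val young_avgJ. Qed.

Lemma specht_valV s : chi (s^-1)%g = chi s.
Proof. by rewrite /specht_val young_avgV. Qed.

Lemma sum_specht_val_sqr : \sum_s chi s ^+ 2 = #|'S_n|%:R.
Proof.
have c2 : c ^+ 2 != 0 by rewrite expf_neq0 // gt_eqF // young_norm_gt0.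
apply: (mulIf c2); rewrite -young_avg_norm // mulr_suml; apply: eq_bigr => s _.
by rewrite -exprMn specht_val_mulr young_avgV expr2.
Qed.

Let phi_irr : phi \in irr G.
Proof.
rewrite irrEchar phi_char cfdotE (eq_bigr (fun s => ((chi s) ^+ 2)%:~R)) => [|s _].
  rewrite -raddf_sum /= (eq_bigl predT) => [|s]; last by rewrite inE.
  rewrite sum_specht_val_sqr -cardsT mulrz_nat.
  apply/eqP/mulVf; exact: neq0CG.
by rewrite chiE rmorph_int expr2 intrM.
Qed.

Lemma specht_val1_gt0 : 0 < chi 1%g.
Proof. by rewrite -(ltr0z algC) -chiE; have /irrP[i ->] := phi_irr; apply: irr1_gt0. Qed.

Lemma specht_val_central (J : finType) (P : pred J) (w : J -> 'S_n)
    (act : 'S_n -> J -> J) :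
  (forall r, injective (act r)) -> (forall r t, P (act r t) = P t) ->
  (forall r t, P t -> w (act r t) = (w t ^ r)%g) ->
  forall s, (\sum_(t | P t) chi (w t * s)%g) * chi 1%g
          = (\sum_(t | P t) chi (w t)) * chi s.
Proof.
move=> inj_a Pa wa s; have c2 : c * c != 0.
  by rewrite mulf_neq0 // gt_eqF // young_norm_gt0.
have sumE (f : J -> 'S_n) :
    (\sum_(t | P t) chi (f t)) * c = \sum_(t | P t) N (f t).
  by rewrite mulr_suml; apply: eq_bigr => t _; rewrite specht_val_mulr.
apply: (mulIf c2); rewrite mulrACA [RHS]mulrACA !sumE !specht_val_mulr.
exact: (young_avg_central hp inj_a Pa wa).
Qed.

(** The multiplicity of the trivial character in the restriction to [H] is [chi 1] divided by the
    order of [H], and it is a natural number. *)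
Lemma dvd_specht_val1 (H : {group 'S_n}) :
  (forall h, h \in H -> h != 1%g -> chi h = 0) -> (#|H| %| `|chi 1%g|)%N.
Proof.
move=> chi0; have : '['Res[H] phi, 1] \is a Num.nat.
  by rewrite Cnat_cfdot_char ?cfRes_char ?cfun1_char.
rewrite cfdotE (bigD1 1%g) //= big1 => [|h /andP[hH h1]]; last first.
  by rewrite cfResE ?subsetT // chiE chi0 // mul0r.
rewrite addr0 cfResE ?subsetT // chiE cfun11 rmorph1 mulr1 => /natrP[m].
move/(congr1 ( *%R #|H|%:R)); rewrite mulVKf ?neq0CG // -natrM.
rewrite -[chi _]gez0_abs ?ltW ?specht_val1_gt0 // -pmulrn => /eqP.
by rewrite eqr_nat => /eqP->; apply: dvdn_mulr.
Qed.

Lemma specht_val_zero : chi 1%g != 1 -> exists s : 'S_n, chi s = 0.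
Proof.
move=> f1; have /irrP[i phi_i] := phi_irr.
have [|s _] := @nonlinear_irr_vanish _ G i.
  rewrite -phi_i chiE ltr1z lt_def f1 /=.
  exact: specht_val1_gt0.
by rewrite -phi_i chiE => /eqP; rewrite intr_eq0 => /eqP; exists s.
Qed.

Lemma young_coef_le1 s : `|@young_coef n p s| <= 1.
Proof.
have [/existsP[[r q] /and3P[/= rR qC /eqP<-]]|no] :=
    boolP [exists x : 'S_n * 'S_n, [&& x.1 \in row_stab n p, x.2 \in col_stab n p
                                & (x.1 * x.2 == s)%g]].
  rewrite young_coef_mull // -[q]mul1g young_coef_mulr // young_coef1 // mulr1.
  by rewrite normr_sign.
rewrite /young_coef big1 ?normr0 // => r rR; rewrite big1 // => q qC.
case: eqP => [rq|]; last by rewrite mulr0.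
by case/existsP: no; exists (r, q); rewrite /= rR qC rq eqxx.
Qed.

(** For a linear character [c] is n! and [chi t] is a sign, the average of the [e (t ^ h)]. As these
    are bounded by 1 in absolute value, all equal [chi t]; but a transposition within a row has
    coefficient 1 and one within a column has coefficient -1. *)
Lemma specht_val1_neq1 : p <> nseq n 1%N -> p <> [:: n] -> chi 1%g != 1.
Proof.
move=> hcol hrow; apply/eqP => chi1.
have [k [l [nkl rkl]]] := exists_row_pair hp hcol.
have [k' [l' [nkl' ckl]]] := exists_col_pair hp (leq_ltn_trans (leq0n k) (ltn_ord k)) hrow.
have [||//|g [gk gl]] := @exists_perm_map _ [:: k; l] [:: k'; l'];
  rewrite /= ?inE ?nkl ?nkl' //.
have cN : c = #|'S_n|%:R by rewrite -(young_avg1 n p) -specht_val_mulr chi1 mul1r.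
pose t := tperm k l; have et : @young_coef n p t = 1.
  by rewrite -[t]mulg1 young_coef_tpermL ?rkl // young_coef1.
have etg : @young_coef n p (t ^ g)%g = -1.
  rewrite /t tpermJ gk gl -[tperm _ _]mul1g young_coef_tpermR ?ckl //.
  by rewrite young_coef1 nkl' mulr1.
have lin : phi \is a linear_char by rewrite qualifE /= phi_char chiE chi1 eqxx.
have t1 : `|chi t| = 1.
  have /eqP := normC_lin_char lin (in_setT t); rewrite chiE -intr_norm.
  by rewrite (eqr_int algC _ 1) => /eqP.
have /psumr_eq0P e1 : \sum_(h : 'S_n) (1 - chi t * @young_coef n p (t ^ h)%g) = 0.
  rewrite sumrB sumr_const -mulr_sumr -/(young_avg p t) -specht_val_mulr cN mulrA.
  by rewrite -expr2 -(real_normK (num_real _)) t1 expr1n mul1r subrr.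
have ge0 (h : 'S_n) : 0 <= 1 - chi t * @young_coef n p (t ^ h)%g.
  by rewrite subr_ge0 (le_trans (ler_norm _)) // normrM t1 mul1r young_coef_le1.
have := e1 (fun h _ => ge0 h) g isT; rewrite etg mulrN1 opprK => tg.
have := e1 (fun h _ => ge0 h) 1%g isT; rewrite conjg1 et mulr1.
by move/eqP; rewrite subr_eq0 => /eqP t2; rewrite -t2 in tg.
Qed.

End SpechtVal.

(* A word is a list of transpositions of positions in a sequence of points; it
   is evaluated either on positions, where everything computes, or as a
   permutation of the points. *)
Definition word := seq (nat * nat).

Definition swapn (i j z : nat) : nat :=
  if z == i then j else if z == j then i else z.

Definition word_nat (W : word) (z : nat) : nat :=
  foldl (fun z x => swapn x.1 x.2 z) z W.

Definition word_lt (k : nat) (W : word) : bool :=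
  all (fun x => (x.1 < k)%N && (x.2 < k)%N) W.

(** * Permutations given by words of transpositions *)

Section WordPerm.

Variables (T : finType) (d : T).

Definition word_perm (s : seq T) (W : word) : {perm T} :=
  (\prod_(x <- W) tperm (nth d s x.1) (nth d s x.2))%g.

Lemma word_perm_cons s x W :
  word_perm s (x :: W) = (tperm (nth d s x.1) (nth d s x.2) * word_perm s W)%g.
Proof. by rewrite /word_perm big_cons. Qed.

Lemma word_permE s W z : uniq s -> word_lt (size s) W -> (z < size s)%N ->
  (word_nat W z < size s)%N /\ word_perm s W (nth d s z) = nth d s (word_nat W z).
Proof.
move=> us; elim: W z => [|[i j] W IHW] z /=; first by rewrite /word_perm big_nil perm1.
move=> /andP[/andP[li lj] lW] lz; rewrite word_perm_cons permM /=.
have lz' : (swapn i j z < size s)%N.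
  by rewrite /swapn; case: eqP => // _; case: eqP.
have [lt eq_z] := IHW _ lW lz'; split=> //; rewrite -eq_z; congr (_ _).
rewrite /swapn; case: (eqVneq z i) => [->|zi]; first by rewrite tpermL.
case: (eqVneq z j) => [->|zj]; first by rewrite tpermR.
by rewrite tpermD // nth_uniq // eq_sym.
Qed.

Lemma word_perm_id s W x : word_lt (size s) W -> x \notin s -> word_perm s W x = x.
Proof.
elim: W => [|[i j] W IHW] /=; first by rewrite /word_perm big_nil perm1.
move=> /andP[/andP[li lj] lW] xs; rewrite word_perm_cons permM /= tpermD ?IHW //.
  by apply: contraNneq xs => <-; apply: mem_nth.
by apply: contraNneq xs => <-; apply: mem_nth.
Qed.

Lemma word_perm_take s m W :
  word_lt m W -> word_perm (take m s) W = word_perm s W.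
Proof.
elim: W => [|[i j] W IHW] /=; first by rewrite /word_perm !big_nil.
by move=> /andP[/andP[li lj] lW]; rewrite !word_perm_cons IHW // !nth_take.
Qed.

Lemma word_perm_map s (g : {perm T}) W : word_lt (size s) W ->
  word_perm (map g s) W = (word_perm s W ^ g)%g.
Proof.
elim: W => [|[i j] W IHW] /=; first by rewrite /word_perm !big_nil conj1g.
move=> /andP[/andP[li lj] lW]; rewrite !word_perm_cons IHW // conjMg tpermJ /=.
by rewrite !(nth_map d).
Qed.

Definition word_conj (k : nat) (r : seq nat) (W1 W2 : word) : bool :=
  [&& perm_eq r (iota 0 k), word_lt k W1, word_lt k W2 &
    all (fun z => word_nat W1 (nth 0%N r z) == nth 0%N r (word_nat W2 z)) (iota 0 k)].

Lemma word_perm_conj s r W1 W2 : uniq s -> word_conj (size s) r W1 W2 ->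
  word_perm [seq nth d s i | i <- r] W2 = word_perm s W1
  /\ uniq [seq nth d s i | i <- r].
Proof.
move=> us /and4P[rk lW1 lW2 /allP rW].
have sr : size r = size s by rewrite (perm_size rk) size_iota.
have rs z : z \in r -> (z < size s)%N.
  by rewrite (perm_mem rk) mem_iota.
set t := [seq _ | _ <- _].
have ts : perm_eq t s.
  by rewrite -[X in perm_eq _ X](mkseq_nth d) /mkseq; apply: perm_map.
have ut : uniq t by rewrite (perm_uniq ts).
have st : size t = size s by rewrite size_map.
split=> //; apply/permP=> x.
have [xt|xt] := boolP (x \in t); last first.
  by rewrite !word_perm_id ?st // -(perm_mem ts).
pose z := index x t; have lz : (z < size s)%N by rewrite -st index_mem.
have lr y : (y < size s)%N -> (nth 0%N r y < size s)%N.
  by move=> ly; apply: rs; rewrite mem_nth ?sr.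
have tE y : (y < size s)%N -> nth d t y = nth d s (nth 0%N r y).
  by move=> ly; rewrite (nth_map 0%N) ?sr.
have -> : x = nth d t z by rewrite nth_index.
have [||lt2 ->] := @word_permE t W2 z ut; rewrite ?st //.
have [||lt1] := @word_permE s W1 (nth 0%N r z) us; rewrite ?lr // [nth d t z]tE // => ->.
rewrite tE; last by rewrite -st.
by congr (nth d s _); apply/esym/eqP/rW; rewrite mem_iota.
Qed.

End WordPerm.

(** Longest cycles come first and fixed points last, so that the concatenation is a relabelling that
    carries [W] to the standard word of its cycle type. This is not proved in general: [word_ok]
    checks it by computation for each word in use. *)
Definition word_cycles (k : nat) (W : word) : seq (seq nat) :=
  rev (sort (fun a b => size a <= size b)%N
    (foldl (fun acc z => if z \in flatten acc then acc
                         else rcons acc (undup (traject (word_nat W) z k)))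
           [::] (iota 0 k))).

Definition word_type (k : nat) (W : word) : seq nat :=
  [seq a <- [seq size c | c <- word_cycles k W] | (1 < a)%N].

(** Each part [a] gives the cycle through [o], [o + 1], ..., [o + a - 1] in this order, written with
    transpositions that all involve [o]. *)
Fixpoint std_word_from (o : nat) (ct : seq nat) : word :=
  if ct is a :: ct' then
    [seq (o, (o + i)%N) | i <- iota 1 a.-1] ++ std_word_from (o + a) ct'
  else [::].

Definition std_word := std_word_from 0.

Definition word_ok (k : nat) (W : word) : bool :=
  let ct := word_type k W in
  [&& word_conj k (flatten (word_cycles k W)) W (std_word ct),
      (sumn ct <= k)%N & word_lt (sumn ct) (std_word ct)].

(** * Sums of a class function over tuples of distinct points *)

Section ClassFunction.

Variables (n : nat) (d : 'I_n) (chi : 'S_n -> int).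
Hypothesis chiJ : forall s g, chi (s ^ g)%g = chi s.

(* The value of [chi] on the class of cycle type [ct] (parts 1 omitted), with
   junk value 0 if there is no such class. *)
Definition class_val (ct : seq nat) : int :=
  if (sumn ct <= n)%N then
    chi (word_perm d (take (sumn ct) (enum 'I_n)) (std_word ct))
  else 0.

Lemma class_val_std ct (s : seq 'I_n) :
  word_lt (sumn ct) (std_word ct) -> uniq s -> size s = sumn ct ->
  chi (word_perm d s (std_word ct)) = class_val ct.
Proof.
move=> lW us ss; have le_n : (sumn ct <= n)%N.
  by rewrite -ss -(card_uniqP us) -[X in (_ <= X)%N](card_ord n) max_card.
rewrite /class_val le_n; set t := take _ _.
have ut : uniq t by rewrite take_uniq ?enum_uniq.
have st : size t = sumn ct by rewrite size_takel // size_enum_ord.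
have [|g gs] := exists_perm_map us ut; first by rewrite ss st.
by rewrite -gs word_perm_map ?ss // chiJ.
Qed.

Lemma class_val_word k W (s : seq 'I_n) :
  word_ok k W -> uniq s -> size s = k ->
  chi (word_perm d s W) = class_val (word_type k W).
Proof.
move=> + us ss; rewrite -{}ss => /and3P[cW le_k lW].
have [<- ut] := word_perm_conj d us cW.
rewrite -(word_perm_take _ _ lW) class_val_std ?take_uniq // size_takel // size_map.
by have /and4P[/perm_size -> _ _ _] := cW; rewrite size_iota.
Qed.

Fixpoint sum_distinct (r : nat) (l : seq 'I_n) (F : seq 'I_n -> int) : int :=
  if r is r'.+1 then \sum_(x | x \notin l) sum_distinct r' (rcons l x) F else F l.

(* [sum_distinct] for [F = chi \o word_perm]: each of the [r] new points is
   either one of the [k] points the word already refers to, or one of the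
   [n - k] other points, which are all equivalent. *)
Fixpoint eval_distinct (r k : nat) (A : seq nat) (W : seq nat -> word) : int :=
  if r is r'.+1 then
    foldr (fun i acc => if i \in A then acc else eval_distinct r' k (rcons A i) W + acc)
      ((n%:R - k%:R) * eval_distinct r' k.+1 (rcons A k) W) (iota 0 k)
  else class_val (word_type k (W A)).

(* The same expansion as a list of monomials, so that it can be computed:
   [(ks, ct)] stands for [\prod_(k in ks) (n - k) * class_val ct]. *)
Fixpoint terms_distinct (r k : nat) (A : seq nat) (W : seq nat -> word) :
    seq (seq nat * seq nat) :=
  if r is r'.+1 then
    foldr (fun i acc => if i \in A then acc else terms_distinct r' k (rcons A i) W ++ acc)
      [seq (k :: t.1, t.2) | t <- terms_distinct r' k.+1 (rcons A k) W] (iota 0 k)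
  else [:: ([::], word_type k (W A))].

Definition sum_terms (l : seq (seq nat * seq nat)) : int :=
  foldr (fun t acc => foldr (fun k x => (n%:R - k%:R) * x) (class_val t.2) t.1 + acc) 0 l.

Lemma sum_terms_cat l1 l2 : sum_terms (l1 ++ l2) = sum_terms l1 + sum_terms l2.
Proof. by elim: l1 => [|t l1 IHl] /=; rewrite ?add0r // IHl addrA. Qed.

Lemma eval_distinct_terms r k A W :
  eval_distinct r k A W = sum_terms (terms_distinct r k A W).
Proof.
elim: r k A => [|r IHr] k A /=; first by rewrite addr0.
elim: (iota 0 k) => [|i l IHl] /=.
  rewrite IHr; elim: (terms_distinct _ _ _ _) => [|t u IHu] /=; first by rewrite mulr0.
  by rewrite mulrDr IHu.
by case: (i \in A) => //; rewrite sum_terms_cat IHr IHl.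
Qed.

Fixpoint ok_distinct (r k : nat) (A : seq nat) (W : seq nat -> word) : bool :=
  if r is r'.+1 then
    all (fun i => (i \in A) || ok_distinct r' k (rcons A i) W) (iota 0 k)
    && ok_distinct r' k.+1 (rcons A k) W
  else word_ok k (W A).

(** Only the positions matter to a class function, so all points outside [s] contribute equally.
    Choosing one of them appends it to [s], which is why the hypothesis on [F] ranges over all
    extensions of [s]. *)
Lemma sum_distinctE r k A W (s : seq 'I_n) (F : seq 'I_n -> int) :
  ok_distinct r k A W -> all (fun i => i < k)%N A -> uniq s -> size s = k ->
  (forall s' B, size B = (r + size A)%N ->
     all (fun i => i < size s')%N B -> word_lt (size s') (W B) ->
     take k s' = s ->
     F [seq nth d s' i | i <- B] = chi (word_perm d s' (W B))) ->
  sum_distinct r [seq nth d s i | i <- A] F = eval_distinct r k A W.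
Proof.
elim: r k A s => [|r IHr] k A s /= okW ltA us ss FE.
  rewrite (FE s) ?ss //; last by rewrite take_oversize ?ss.
    exact: class_val_word.
  by case/and3P: okW => /and4P[].
have /andP[/allP ok1 ok2] := okW.
have memA i : (i < k)%N -> (nth d s i \in [seq nth d s j | j <- A]) = (i \in A).
  move=> lt_i; apply/mapP/idP => [[j jA /eqP]|iA]; last by exists i.
  by rewrite nth_uniq ?ss //; [move/eqP-> | apply: (allP ltA)].
have inA x : x \in [seq nth d s j | j <- A] -> x \in s.
  by case/mapP=> j jA ->; rewrite mem_nth // ss (allP ltA).
rewrite (bigID (mem s)) /= addrC.
have -> : \sum_(x | (x \notin [seq nth d s i | i <- A]) && (x \in s))
    sum_distinct r (rcons [seq nth d s i | i <- A] x) F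
  = \sum_(i <- iota 0 k | i \notin A) eval_distinct r k (rcons A i) W.
  rewrite (eq_bigl (fun x => (x \in s) && (x \notin [seq nth d s i | i <- A])));
    last by move=> x; rewrite andbC.
  rewrite -big_filter_cond (perm_big s) /=; last first.
    by apply: uniq_perm => [||x]; rewrite ?filter_uniq ?index_enum_uniq // mem_filter mem_index_enum andbT.
  rewrite -{1}(mkseq_nth d s) /mkseq ss big_map big_seq_cond [RHS]big_seq_cond.
  apply: eq_big => [i|i /andP[]]; rewrite mem_iota add0n /=.
    by case: (ltnP i k) => //= lt_i; rewrite memA.
  move=> lt_i iA; have iA' : i \notin A by rewrite -memA.
  rewrite -map_rcons; apply: IHr => //.
  - by have := ok1 i; rewrite mem_iota (negbTE iA') => /(_ lt_i).
  - by rewrite all_rcons lt_i.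
  by move=> s' B sB; apply: FE; rewrite sB size_rcons addnS.
have out x : x \notin s -> sum_distinct r (rcons [seq nth d s i | i <- A] x) F
    = eval_distinct r k.+1 (rcons A k) W.
  move=> xs; have -> : rcons [seq nth d s i | i <- A] x
      = [seq nth d (rcons s x) i | i <- rcons A k].
    rewrite map_rcons nth_rcons ss ltnn eqxx; congr rcons.
    by apply/eq_in_map => i iA; rewrite nth_rcons ss (allP ltA).
  apply: IHr => //.
  - rewrite all_rcons ltnSn; apply: sub_all ltA => i; exact: ltnW.
  - by rewrite rcons_uniq xs.
  - by rewrite size_rcons ss.
  move=> s' B sB ltB lW ts; apply: FE => //; first by rewrite sB size_rcons addnS.
  by rewrite -[RHS](take_size_cat [:: x] ss) cats1 -ts take_takel.
have -> : \sum_(x | (x \notin [seq nth d s i | i <- A]) && (x \notin s))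
    sum_distinct r (rcons [seq nth d s i | i <- A] x) F
  = (n%:R - k%:R) * eval_distinct r k.+1 (rcons A k) W.
  rewrite (eq_bigl (fun x => x \notin s)) => [|x]; last first.
    by rewrite andbC andb_idr //; apply/contraNN/inA.
  rewrite (eq_bigr _ (fun x => @out x)) sumr_const -[LHS]mulr_natl; congr (_ * _).
  have := cardC (mem s); rewrite card_ord (card_uniqP us) ss => nE.
  apply: (addIr k%:R); rewrite subrK -natrD addnC; congr _%:R.
  by rewrite -[RHS]nE; congr addn; apply: eq_card.
elim: (iota 0 k) => [|i l IHl] /=; first by rewrite big_nil addr0.
by rewrite big_cons; case: (i \in A) => //=; rewrite -IHl addrCA.
Qed.

Lemma sum_distinct2 (F : seq 'I_n -> int) :
  sum_distinct 2 [::] F = \sum_(t : 'I_n * 'I_n | t.1 != t.2) F [:: t.1; t.2].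
Proof.
rewrite /= pair_big_dep /=; apply: eq_bigl => t.
by rewrite !inE eq_sym.
Qed.

Lemma sum_distinct3 (F : seq 'I_n -> int) :
  sum_distinct 3 [::] F =
  \sum_(t : 'I_n * 'I_n * 'I_n | uniq [:: t.1.1; t.1.2; t.2]) F [:: t.1.1; t.1.2; t.2].
Proof.
rewrite /= pair_big_dep /= pair_big_dep /=; apply: eq_bigl => t.
rewrite !inE !negb_or andbT (eq_sym t.1.1 t.1.2) (eq_sym t.1.1 t.2) (eq_sym t.1.2 t.2).
by rewrite andbA.
Qed.

End ClassFunction.

(** A class sum acts on an irreducible module by a scalar, whence this relation. Indexing by a
    family with an action, instead of a class, allows sums over ordered tuples of points. *)
Definition central_function (n : nat) (chi : 'S_n -> int) : Prop :=
  forall (J : finType) (P : pred J) (w : J -> 'S_n) (act : 'S_n -> J -> J),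
  (forall r, injective (act r)) -> (forall r t, P (act r t) = P t) ->
  (forall r t, P t -> w (act r t) = (w t ^ r)%g) ->
  forall s, (\sum_(t | P t) chi (w t * s)%g) * chi 1%g
          = (\sum_(t | P t) chi (w t)) * chi s.

(** * Relations between values on small classes *)

Section ClassIdentities.

Variables (n : nat) (d : 'I_n) (chi : 'S_n -> int).
Hypothesis chiJ : forall s g, chi (s ^ g)%g = chi s.
Hypothesis chiC : central_function chi.

Local Notation X := (class_val d chi).
Local Notation E := (eval_distinct d chi).

Definition add_tperm (W : word) (A : seq nat) : word :=
  (nth 0 A 0, nth 0 A 1)%N :: W.

Definition add_cycle3 (W : word) (A : seq nat) : word :=
  [:: (nth 0 A 0, nth 0 A 1), (nth 0 A 0, nth 0 A 2) & W]%N.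

Lemma exists_uniq_seq k : (k <= n)%N -> exists2 s : seq 'I_n, uniq s & size s = k.
Proof.
move=> le_k; exists (take k (enum 'I_n)); first by rewrite take_uniq ?enum_uniq.
by rewrite size_takel // size_enum_ord.
Qed.

Lemma tperm_class_sum k W : (k <= n)%N -> word_ok k W ->
  ok_distinct 2 k [::] (add_tperm W) -> ok_distinct 2 0 [::] (add_tperm [::]) ->
  E 2 k [::] (add_tperm W) * chi 1%g = E 2 0 [::] (add_tperm [::]) * X (word_type k W).
Proof.
move=> /exists_uniq_seq[s us ss] okW ok1 ok2.
rewrite -(class_val_word d chiJ okW us ss).
have sumE (k' : nat) W' (s' : seq 'I_n) : size s' = k' -> uniq s' -> word_lt k' W' ->
    ok_distinct 2 k' [::] (add_tperm W') ->
    \sum_(t : 'I_n * 'I_n | t.1 != t.2) chi (tperm t.1 t.2 * word_perm d s' W')%g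
      = E 2 k' [::] (add_tperm W').
  move=> ss' us' lW' ok'; pose F l := chi (tperm (nth d l 0) (nth d l 1) * word_perm d s' W')%g.
  rewrite -(sum_distinct2 F); apply: (sum_distinctE chiJ ok' _ us' ss') => // t B sB ltB lW ts.
  rewrite /F word_perm_cons -ts word_perm_take //.
  by rewrite !(nth_map 0%N) ?sB.
rewrite -(sumE k W s) //; last by case/and3P: okW => /and4P[].
rewrite -(sumE 0%N [::] [::]) //.
under [in RHS]eq_bigr => t _ do rewrite /word_perm big_nil mulg1.
pose act (r : 'S_n) (t : 'I_n * 'I_n) := (r t.1, r t.2).
apply: (chiC (act := act)) => [r [x y] [x' y'] [/perm_inj-> /perm_inj->]|r t|r t _] //=.
  by rewrite (inj_eq perm_inj).
by rewrite tpermJ.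
Qed.

Lemma cycle3_class_sum k W : (k <= n)%N -> word_ok k W ->
  ok_distinct 3 k [::] (add_cycle3 W) -> ok_distinct 3 0 [::] (add_cycle3 [::]) ->
  E 3 k [::] (add_cycle3 W) * chi 1%g = E 3 0 [::] (add_cycle3 [::]) * X (word_type k W).
Proof.
move=> /exists_uniq_seq[s us ss] okW ok1 ok2.
rewrite -(class_val_word d chiJ okW us ss).
pose w (t : 'I_n * 'I_n * 'I_n) := (tperm t.1.1 t.1.2 * tperm t.1.1 t.2)%g.
have sumE (k' : nat) W' (s' : seq 'I_n) : size s' = k' -> uniq s' -> word_lt k' W' ->
    ok_distinct 3 k' [::] (add_cycle3 W') ->
    \sum_(t | uniq [:: t.1.1; t.1.2; t.2]) chi (w t * word_perm d s' W')%g
      = E 3 k' [::] (add_cycle3 W').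
  move=> ss' us' lW' ok'; pose F l := chi (tperm (nth d l 0) (nth d l 1) *
     tperm (nth d l 0) (nth d l 2) * word_perm d s' W')%g.
  rewrite -(sum_distinct3 F); apply: (sum_distinctE chiJ ok' _ us' ss') => // t B sB ltB lW ts.
  rewrite /F !word_perm_cons -ts word_perm_take // mulgA.
  by rewrite !(nth_map 0%N) ?sB.
rewrite -(sumE k W s) //; last by case/and3P: okW => /and4P[].
rewrite -(sumE 0%N [::] [::]) //.
under [in RHS]eq_bigr => t _ do rewrite /word_perm big_nil mulg1.
pose act (r : 'S_n) (t : 'I_n * 'I_n * 'I_n) := (r t.1.1, r t.1.2, r t.2).
apply: (chiC (act := act)) => [r [[x y] z] [[x' y'] z']|r t|r t _] /=.
- by case=> /perm_inj-> /perm_inj-> /perm_inj->.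
- by rewrite !inE !(inj_eq perm_inj).
by rewrite /w conjMg !tpermJ.
Qed.

Local Notation m := (n%:R : int).

Lemma class_val_nil : X [::] = chi 1%g.
Proof. by rewrite /class_val /= take0 /word_perm big_nil. Qed.

(* The identities below evaluate in two ways the product of the class sum of
   transpositions (of 3-cycles in [class_identity33]) with one permutation. *)
Ltac class_terms :=
  rewrite !eval_distinct_terms;
  repeat match goal with |- context [terms_distinct ?r ?k ?A ?W] =>
    let l := eval vm_compute in (terms_distinct r k A W) in
    have -> : terms_distinct r k A W = l by vm_compute
  end;
  rewrite /sum_terms /= ?class_val_nil.

(** The coefficients count ordered pairs of points: 2 of them cancel the given transposition,
    [4 * (m - 2)] share one point with it and [(m - 2) * (m - 3)] are disjoint from it. The later
    identities count in the same way. *)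
Lemma class_identity2 : (2 <= n)%N ->
  (2 * chi 1%g + 4 * (m - 2) * X [:: 3]%N + (m - 2) * (m - 3) * X [:: 2; 2]%N) * chi 1%g
   = m * (m - 1) * X [:: 2]%N ^+ 2.
Proof.
move=> n2; have := @tperm_class_sum 2 [:: (0, 1)]%N n2 isT isT isT.
class_terms.
rewrite (_ : word_type _ _ = [:: 2%N]); last by vm_compute.
by move=> e; apply: (etrans _ (etrans e _)); ring.
Qed.

Lemma class_identity3 : (3 <= n)%N ->
  (6 * X [:: 2]%N + 6 * (m - 3) * X [:: 4]%N + (m - 3) * (m - 4) * X [:: 3; 2]%N) * chi 1%g
   = m * (m - 1) * X [:: 2]%N * X [:: 3]%N.
Proof.
move=> n3; have := @tperm_class_sum 3 [:: (0, 1); (0, 2)]%N n3 isT isT isT.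
class_terms.
rewrite (_ : word_type _ _ = [:: 3%N]); last by vm_compute.
by move=> e; apply: (etrans _ (etrans e _)); ring.
Qed.

Lemma class_identity4 : (4 <= n)%N ->
  (8 * X [:: 3]%N + 4 * X [:: 2; 2]%N + 8 * (m - 4) * X [:: 5]%N
     + (m - 4) * (m - 5) * X [:: 4; 2]%N) * chi 1%g
   = m * (m - 1) * X [:: 2]%N * X [:: 4]%N.
Proof.
move=> n4; have := @tperm_class_sum 4 [:: (0, 1); (0, 2); (0, 3)]%N n4 isT isT isT.
class_terms.
rewrite (_ : word_type _ _ = [:: 4%N]); last by vm_compute.
by move=> e; apply: (etrans _ (etrans e _)); ring.
Qed.

Lemma class_identity32 : (5 <= n)%N ->
  (6 * X [:: 2; 2]%N + 2 * X [:: 3]%N + 12 * X [:: 5]%N + 6 * (m - 5) * X [:: 4; 2]%N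
     + 4 * (m - 5) * X [:: 3; 3]%N + (m - 5) * (m - 6) * X [:: 3; 2; 2]%N) * chi 1%g
   = m * (m - 1) * X [:: 2]%N * X [:: 3; 2]%N.
Proof.
move=> n5; have := @tperm_class_sum 5 [:: (0, 1); (0, 2); (3, 4)]%N n5 isT isT isT.
class_terms.
rewrite (_ : word_type _ _ = [:: 3; 2]%N); last by vm_compute.
by move=> e; apply: (etrans _ (etrans e _)); ring.
Qed.

Lemma class_identity33 : (3 <= n)%N ->
  (3 * chi 1%g + 3 * X [:: 3]%N + 9 * (m - 3) * (X [:: 2; 2]%N + X [:: 3]%N)
     + 9 * (m - 3) * (m - 4) * X [:: 5]%N
     + (m - 3) * (m - 4) * (m - 5) * X [:: 3; 3]%N) * chi 1%g
   = m * (m - 1) * (m - 2) * X [:: 3]%N ^+ 2.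
Proof.
move=> n3; have := @cycle3_class_sum 3 [:: (0, 1); (0, 2)]%N n3 isT isT isT.
class_terms.
rewrite (_ : word_type _ _ = [:: 3%N]); last by vm_compute.
by move=> e; apply: (etrans _ (etrans e _)); ring.
Qed.

End ClassIdentities.

(** * Numbers of points moved by the support *)

Definition moved (T : finType) (s : {perm T}) : nat := #|[set x | s x != x]|.

Lemma moved_word_perm (T : finType) (d : T) s W : uniq s -> word_lt (size s) W ->
  all (fun z => word_nat W z != z) (iota 0 (size s)) ->
  moved (word_perm d s W) = size s.
Proof.
move=> us lW /allP mv; rewrite -(card_uniqP us); apply: eq_card => x; rewrite inE.
have [xs|xs] := boolP (x \in s); last by rewrite word_perm_id ?eqxx.
have lx : (index x s < size s)%N by rewrite index_mem.
have [lt] := word_permE d us lW lx; rewrite nth_index // => ->.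
rewrite -{2}(nth_index d xs) nth_uniq //; apply: mv; by rewrite mem_iota.
Qed.

Lemma word_perm_order (T : finType) (d : T) s W q : prime q -> uniq s ->
  word_lt (size s) W -> (0 < size s)%N -> word_nat W 0 != 0 ->
  all (fun z => iter q (word_nat W) z == z) (iota 0 (size s)) ->
  #[word_perm d s W]%g = q.
Proof.
move=> q_pr us lW s0 W0 /allP Wq; apply: nt_prime_order => //; last first.
  apply: contraNneq W0 => w1; have [lt] := word_permE d us lW s0.
  by rewrite w1 perm1 => /eqP; rewrite nth_uniq // eq_sym.
have it k z : (z < size s)%N -> (iter k (word_nat W) z < size s)%N /\
    (word_perm d s W ^+ k)%g (nth d s z) = nth d s (iter k (word_nat W) z).
  move=> lz; elim: k => [|k [lk IHk]] /=; first by rewrite expg0 perm1.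
  have [? e] := word_permE d us lW lk; split=> //.
  by rewrite expgSr permM IHk e.
apply/permP=> x; rewrite perm1.
have [xs|xs] := boolP (x \in s); last first.
  by elim: q {q_pr Wq} => [|k IHk]; rewrite ?expg0 ?perm1 // expgSr permM IHk word_perm_id.
have lx : (index x s < size s)%N by rewrite index_mem.
have [_] := it q _ lx; rewrite nth_index // => ->.
have /eqP -> : iter q (word_nat W) (index x s) == index x s.
  by apply: Wq; rewrite mem_iota.
by rewrite nth_index.
Qed.

Lemma moved_cycle (T : finType) (g h : {perm T}) : prime #[g]%g ->
  h \in <[g]>%g -> h != 1%g -> moved h = moved g.
Proof.
move=> g_pr hg h1; have gh : g \in <[h]>%g.
  have : (<[h]> == <[g]>)%g.
    rewrite eqEcard cycle_subG hg /= dvdn_leq ?order_gt0 //.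
    have := order_dvdG hg; rewrite -/(#[g]%g) => dv.
    case/primeP: g_pr => _ /(_ _ dv); rewrite order_eq1 (negbTE h1) /= => /eqP.
    by rewrite /order => ->.
  by move/eqP->; apply: cycle_id.
have fix_pow (u v : {perm T}) x : v \in <[u]>%g -> u x = x -> v x = x.
  case/cycleP=> k -> ux; elim: k => [|k IHk]; first by rewrite expg0 perm1.
  by rewrite expgSr permM IHk.
apply: eq_card => x; rewrite !inE; congr (~~ _); apply/eqP/eqP; exact: fix_pow.
Qed.

Lemma fact_lt_sqr n : (5 <= n)%N -> (n`! < n.-1`! ^ 2)%N.
Proof.
case: n => [|[|[|[|[|k]]]]] // _; rewrite -mulnn [in X in (X < _)%N]factS /=.
rewrite ltn_pmul2r ?fact_gt0 // !factS; have := fact_gt0 k; nia.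
Qed.

Section MovedPoints.

Variables (n : nat) (chi : 'S_n -> int).
Hypothesis n5 : (5 <= n)%N.
Hypothesis chiJ : forall s g, chi (s ^ g)%g = chi s.
Hypothesis chiC : central_function chi.
Hypothesis chi1_gt0 : 0 < chi 1%g.
Hypothesis chi_norm : \sum_s chi s ^+ 2 = #|'S_n|%:R.
Hypothesis chi_dvd : forall H : {group 'S_n},
  (forall h, h \in H -> h != 1%g -> chi h = 0) -> (#|H| %| `|chi 1%g|)%N.

Lemma chi1_sqr_le : (`|chi 1%g| ^ 2 <= n`!)%N.
Proof.
rewrite -(ler_nat int) natrX natz gez0_abs ?(ltW chi1_gt0) //.
have -> : n`! = #|'S_n| by rewrite card_Sn.
rewrite -chi_norm (bigD1 1%g) //= lerDl sumr_ge0 // => s _; exact: sqr_ge0.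
Qed.

(** Otherwise [dvd_specht_val1], for the point stabilizer, would make (n-1)! divide the degree,
    whose square is at most n!; for n at least 5 this is too small. *)
Lemma exists_fixed_support (x : 'I_n) :
  exists s : 'S_n, [/\ s x = x, s != 1%g & chi s != 0].
Proof.
pose H := perm.Sym [set~ x].
have H_dvd : ~~ [exists s : 'S_n, [&& s x == x, s != 1%g & chi s != 0]] ->
    (n.-1`! %| `|chi 1%g|)%N.
  move=> /existsPn no; have -> : n.-1`! = #|H|.
    by rewrite perm.card_Sym cardsC1 card_ord.
  apply: chi_dvd => h hH h1; apply/eqP; have := no h; rewrite h1 /=.
  rewrite negb_and negbK => /orP[|//]; rewrite inE in hH.
  by rewrite (out_perm hH) ?eqxx // !inE eqxx.
have [/existsP[s /and3P[/eqP ? ? ?]]|/H_dvd dv] :=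
  boolP [exists s : 'S_n, [&& s x == x, s != 1%g & chi s != 0]]; first by exists s.
have f_gt0 : (0 < `|chi 1%g|)%N by rewrite absz_gt0 gt_eqF.
have := fact_lt_sqr n5; rewrite ltnNge => /negP[].
by apply: leq_trans chi1_sqr_le; rewrite leq_sqr dvdn_leq.
Qed.

Variables (d0 : 'I_n) (R : idomainType) (d : R).
Hypothesis d_moved : forall s, chi s != 0 -> d ^+ moved s = 1.

Local Notation X := (class_val d0 chi).
Local Notation f := (chi 1%g).
Local Notation m := (n%:R : int).

Lemma class_val_neq0 ct : X ct != 0 ->
  word_lt (sumn ct) (std_word ct) ->
  all (fun z => word_nat (std_word ct) z != z) (iota 0 (sumn ct)) ->
  d ^+ sumn ct = 1.
Proof.
rewrite /class_val; case: ifP => [le_n X0 lW mv|]; last by rewrite eqxx.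
have ut : uniq (take (sumn ct) (enum 'I_n)) by rewrite take_uniq ?enum_uniq.
have st : size (take (sumn ct) (enum 'I_n)) = sumn ct by rewrite size_takel // size_enum_ord.
rewrite -[X in _ ^+ X]st -(@moved_word_perm _ d0 _ (std_word ct) ut) ?st //.
exact: d_moved.
Qed.

Lemma class_val_eq0 ct : d ^+ sumn ct != 1 ->
  word_lt (sumn ct) (std_word ct) ->
  all (fun z => word_nat (std_word ct) z != z) (iota 0 (sumn ct)) ->
  X ct = 0.
Proof.
by move=> dk lW mv; apply/eqP; apply: contraNT dk => /class_val_neq0 ->.
Qed.

(** All nontrivial powers of a cycle of length [q] move exactly [q] points, so none is in the
    support. The bound 8 leaves finitely many words to check by computation. *)
Lemma prime_dvd_chi1 q : prime q -> (q <= n)%N -> d ^+ q != 1 ->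
  (q < 8)%N -> (q %| `|f|)%N.
Proof.
move=> q_pr le_n dq lt_q.
pose W := std_word [:: q].
have [s us ss] := exists_uniq_seq le_n.
have [lW it mv W0] : [/\ word_lt q W,
   all (fun z => iter q (word_nat W) z == z) (iota 0 q),
   all (fun z => word_nat W z != z) (iota 0 q) & word_nat W 0 != 0].
  by rewrite /W; case: q q_pr lt_q {le_n dq ss W} => [|[|[|[|[|[|[|[|q]]]]]]]].
have og : #[word_perm d0 s W]%g = q.
  by apply: word_perm_order; rewrite ?ss // prime_gt0.
rewrite -{1}og; apply: chi_dvd => h hg h1; apply/eqP; apply: contraNT dq => /d_moved.
by rewrite (moved_cycle _ hg h1) ?og // moved_word_perm ?ss // => ->.
Qed.

(* If [d = -1], the support consists of permutations moving an even number of
   points; the class identities then give [n <= 8]. For [n = 5, 6, 7] they make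
   a nonsquare rational a square, and for [n = 8] the degree is divisible by 210,
   contradicting [chi 1 ^ 2 <= 8!]. *)
Lemma moved_exp2 : d ^+ 2 = 1 -> d = 1.
Proof.
move=> d2; apply/eqP/negPn/negP => d1.
have dodd k : d ^+ (k.*2.+1) != 1.
  by rewrite exprS -mul2n exprM d2 expr1n mulr1.
have X3 : X [:: 3]%N = 0 by apply: class_val_eq0; rewrite ?(dodd 1).
have X5 : X [:: 5]%N = 0 by apply: class_val_eq0; rewrite ?(dodd 2).
have X32 : X [:: 3; 2]%N = 0 by apply: class_val_eq0; rewrite ?(dodd 2).
have X322 : X [:: 3; 2; 2]%N = 0 by apply: class_val_eq0; rewrite ?(dodd 3).
have f0 : f != 0 by rewrite gt_eqF.
have := class_identity2 d0 chiJ chiC (leq_trans (isT : 1 < 5)%N n5).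
have := class_identity3 d0 chiJ chiC (leq_trans (isT : 2 < 5)%N n5).
have := class_identity4 d0 chiJ chiC (leq_trans (isT : 3 < 5)%N n5).
have := class_identity32 d0 chiJ chiC n5.
have := class_identity33 d0 chiJ chiC (leq_trans (isT : 2 < 5)%N n5).
rewrite X3 X5 X32 X322.
have [x2 X2] : exists x, X [:: 2]%N = x by exists (X [:: 2]%N).
rewrite X2; move: (X [:: 4]%N) (X [:: 2; 2]%N) (X [:: 4; 2]%N) (X [:: 3; 3]%N).
move=> x4 x22 x42 x33 e33 e32 e4 e3 e2.
have {}e3 : x2 = - (m - 3) * x4 by apply: (mulIf f0); lra.
have {}e32 : 3 * x22 + 3 * (m - 5) * x42 + 2 * (m - 5) * x33 = 0.
  by apply: (mulIf f0); lra.
have {}e33 : 3 * f + 9 * (m - 3) * x22 + (m - 3) * (m - 4) * (m - 5) * x33 = 0.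
  by apply: (mulIf f0); lra.
have {}e4 : (m - 3) * (4 * x22 + (m - 4) * (m - 5) * x42)
    = - (2 * f + (m - 2) * (m - 3) * x22).
  have := congr1 ( *%R (m - 3)) e4; have := congr1 ( *%R (m * (m - 1) * x2)) e3.
  by move=> ? ?; apply: (mulIf f0); lra.
have y22 : 3 * (m - 3) * x22 = - f.
  have := congr1 ( *%R ((m - 3) * (m - 4))) e32; lra.
have {}e2 : 3 * m * (m - 1) * x2 ^+ 2 = (8 - m) * f ^+ 2.
  have := congr1 ( *%R^~ ((m - 2) * f)) y22; lra.
have n8 : (n <= 8)%N.
  rewrite leqNgt; apply/negP => n9.
  have m9 : 8 - m < 0 by rewrite subr_lt0 (ltr_nat int 8).
  have : 0 <= 3 * m * (m - 1) * x2 ^+ 2.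
    apply: mulr_ge0 (sqr_ge0 _); rewrite !mulr_ge0 ?ler0n ?subr_ge0 //.
    by rewrite (ler_nat int 1) (leq_trans _ n9).
  by rewrite e2 leNgt pmulr_llt0 ?exprn_gt0 // m9.
have no_root (a q : nat) : prime q -> odd (logn q a) -> (0 < a)%N ->
    a%:R * x2 ^+ 2 <> f ^+ 2.
  move=> q_pr odd_a a0 e; have x20 : x2 != 0.
    by apply: contraNneq f0 => x20; rewrite -sqrf_eq0 -e x20 expr0n mulr0.
  move/(congr1 absz): e => /(congr1 (logn q)) /(congr1 odd).
  rewrite abszM !abszX natz absz_nat lognM ?expn_gt0 ?absz_gt0 ?x20 // !lognX.
  by rewrite oddD !oddM odd_a.
have range58 k : (5 <= k)%N -> (k <= 8)%N -> [|| k == 5, k == 6, k == 7 | k == 8]%N.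
  by case: k => [|[|[|[|[|[|[|[|[]]]]]]]]].
have [/or4P[] /eqP nE] := range58 n n5 n8;
  have mE := congr1 (fun k => k%:R : int) nE; rewrite /= mE in e2.
- by apply: (@no_root 20%N 5%N) => //; lra.
- by apply: (@no_root 45%N 5%N) => //; lra.
- by apply: (@no_root 126%N 7%N) => //; lra.
have x20 : x2 = 0 by apply/eqP; rewrite -sqrf_eq0; apply/eqP; lra.
have dv q : prime q -> (q < 8)%N -> odd q -> (q %| `|f|)%N.
  move=> q_pr q8 q_odd; apply: prime_dvd_chi1 => //; first by rewrite nE ltnW.
  by rewrite -(odd_double_half q) q_odd dodd.
have [[d3 d5] d7] := (dv 3%N isT isT isT, dv 5%N isT isT isT, dv 7%N isT isT isT).
have d2' : (2 %| `|f|)%N.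
  have [s us ss] := exists_uniq_seq (leq_trans (isT : 1 < 5)%N n5).
  have og : #[word_perm d0 s [:: (0, 1)]%N]%g = 2%N.
    by apply: word_perm_order; rewrite ?ss.
  rewrite -[X in (X %| _)%N]og; apply: chi_dvd => h hg h1.
  have : h \in <[word_perm d0 s [:: (0, 1)]%N]>%g := hg.
  rewrite (cycle2g og) !inE (negbTE h1) /= => /eqP ->.
  by rewrite (@class_val_word _ d0 _ chiJ 2 [:: (0, 1)]%N s isT us ss) -[RHS]x20 -X2.
have : (210 %| `|f|)%N.
  by rewrite -[210%N]/(2 * (3 * (5 * 7)))%N !Gauss_dvd ?d3 ?d5 ?d7 ?d2'.
move=> /dvdn_leq; rewrite absz_gt0 f0 => /(_ isT) f210.
have : (210 ^ 2 <= n`!)%N by apply: leq_trans chi1_sqr_le; rewrite leq_sqr.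
rewrite (_ : n`! = 8`!); last by rewrite nE.
by rewrite !factS fact0.
Qed.

(** If [d] were a primitive cube root of unity, the support would move only multiples of 3 points.
    Of the classes in the identities there remain those of types (3), (4,2) and (3,3); eliminating
    the last two leaves [(m - 3) * (m - 2) * x3 ^+ 2 = 0], although [f = - 2 * (m - 2) * x3] is
    nonzero. *)
Lemma moved_exp3 : d ^+ 3 = 1 -> d = 1.
Proof.
move=> d3; apply/eqP/negPn/negP => d1.
have d2 : d ^+ 2 != 1.
  by apply: contraNneq d1 => d2; rewrite -[d]mulr1 -d2 -exprS d3 d2.
have dE k r : d ^+ (k * 3 + r) = d ^+ r by rewrite exprD mulnC exprM d3 expr1n mul1r.
have X2 : X [:: 2]%N = 0 by apply: class_val_eq0.
have X4 : X [:: 4]%N = 0 by apply: class_val_eq0; rewrite ?(dE 1%N 1%N).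
have X22 : X [:: 2; 2]%N = 0 by apply: class_val_eq0; rewrite ?(dE 1%N 1%N).
have X5 : X [:: 5]%N = 0 by apply: class_val_eq0; rewrite ?(dE 1%N 2%N).
have X32 : X [:: 3; 2]%N = 0 by apply: class_val_eq0; rewrite ?(dE 1%N 2%N).
have X322 : X [:: 3; 2; 2]%N = 0 by apply: class_val_eq0; rewrite ?(dE 2%N 1%N).
have f0 : f != 0 by rewrite gt_eqF.
have := class_identity2 d0 chiJ chiC (leq_trans (isT : 1 < 5)%N n5).
have := class_identity4 d0 chiJ chiC (leq_trans (isT : 3 < 5)%N n5).
have := class_identity32 d0 chiJ chiC n5.
have := class_identity33 d0 chiJ chiC (leq_trans (isT : 2 < 5)%N n5).
rewrite X2 X4 X22 X5 X32 X322.
move: (X [:: 3]%N) (X [:: 4; 2]%N) (X [:: 3; 3]%N) => x3 x42 x33 e33 e32 e4 e2.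
have {}e2 : f = - 2 * (m - 2) * x3.
  have {}e2 : 2 * f + 4 * (m - 2) * x3 = 0 by apply: (mulIf f0); lra.
  by lra.
have {}e4 : 8 * x3 + (m - 4) * (m - 5) * x42 = 0 by apply: (mulIf f0); lra.
have {}e32 : x3 + 3 * (m - 5) * x42 + 2 * (m - 5) * x33 = 0.
  by apply: (mulIf f0); lra.
have x30 : x3 != 0 by apply: contraNneq f0 => x30; rewrite e2 x30 mulr0.
have m_neq (k : nat) : (k < 5)%N -> m - k%:R != 0.
  move=> lt_k; rewrite subr_eq0 (eqr_nat int); apply: contraTneq n5 => ->.
  by rewrite -ltnNge.
have {}e32 : 2 * ((m - 4) * (m - 5) * x33) = (28 - m) * x3.
  have := congr1 ( *%R (m - 4)) e32; lra.
have : (m - 3) * ((m - 2) * x3 ^+ 2) = 0.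
  have h1 := congr1 ( *%R ((m - 3) * f)) e32.
  rewrite e2 in e33 h1; lra.
by move/eqP; rewrite !mulf_eq0 (negbTE x30) !(negbTE (m_neq _ _)).
Qed.

End MovedPoints.

Section MovedExponent.

Variables (n : nat) (chi : 'S_n -> int).
Hypothesis n5 : (5 <= n)%N.
Hypothesis chiJ : forall s g, chi (s ^ g)%g = chi s.
Hypothesis chiC : central_function chi.
Hypothesis chi1_gt0 : 0 < chi 1%g.
Hypothesis chi_norm : \sum_s chi s ^+ 2 = #|'S_n|%:R.
Hypothesis chi_dvd : forall H : {group 'S_n},
  (forall h, h \in H -> h != 1%g -> chi h = 0) -> (#|H| %| `|chi 1%g|)%N.

(** If neither the square nor the cube of [d] is 1, transpositions and 3-cycles are outside the
    support, and [class_identity2] forces double transpositions into it. So [d ^+ 4 = 1], and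
    [moved_exp2] applies to [d ^+ 2]. *)
Lemma moved_exp_eq1 (R : idomainType) (d : R) :
  (forall s, chi s != 0 -> d ^+ moved s = 1) -> d = 1.
Proof.
move=> d_moved; have d0 : 'I_n := Ordinal (leq_trans (isT : 0 < 5)%N n5).
have [d2|d2] := eqVneq (d ^+ 2) 1; first exact: (moved_exp2 n5 chiJ chiC chi1_gt0 chi_norm chi_dvd d0 d_moved).
have [d3|d3] := eqVneq (d ^+ 3) 1; first exact: (moved_exp3 n5 chiJ chiC chi1_gt0 d0 d_moved).
have d4 : d ^+ 4 = 1.
  apply: (@class_val_neq0 _ _ d0 _ _ d_moved [:: 2; 2]%N _ isT isT).
  apply: contraTneq chi1_gt0 => X22; rewrite -leNgt.
  have := class_identity2 d0 chiJ chiC (leq_trans (isT : 1 < 5)%N n5).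
  rewrite X22 !(class_val_eq0 _ d_moved) // mulr0 mulr0 !addr0 expr0n mulr0 => /eqP.
  by rewrite mulf_eq0 mulf_eq0 /= orbb => /eqP->.
have dd_moved s : chi s != 0 -> (d ^+ 2) ^+ moved s = 1.
  by move=> s0; rewrite exprAC d_moved // expr1n.
have := moved_exp2 n5 chiJ chiC chi1_gt0 chi_norm chi_dvd (Ordinal (leq_trans (isT : 0 < 5)%N n5)) dd_moved.
by rewrite -exprM d4 => /(_ erefl) /eqP; rewrite (negbTE d2).
Qed.

End MovedExponent.

(** All that the determination of the stabilizer needs to know about the character. The partition
    enters through [imch_odd], where it is not symmetric, and [imch_zero], where the character is
    not linear. *)
Record immanant_character (n : nat) (chi : 'S_n -> int) : Prop := {
  imchJ : forall s g, chi (s ^ g)%g = chi s;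
  imchV : forall s, chi (s^-1)%g = chi s;
  imchC : central_function chi;
  imch_gt0 : 0 < chi 1%g;
  imch_norm : \sum_s chi s ^+ 2 = #|'S_n|%:R;
  imch_dvd : forall H : {group 'S_n},
    (forall h, h \in H -> h != 1%g -> chi h = 0) -> (#|H| %| `|chi 1%g|)%N;
  imch_odd : exists2 s : 'S_n, odd_perm s & chi s != 0;
  imch_zero : exists s : 'S_n, chi s = 0
}.

(** * Diagonal maps in the stabilizer *)

Section SupportTorus.

Variables (n : nat) (chi : 'S_n -> int).
Hypothesis n5 : (5 <= n)%N.
Hypothesis chiP : immanant_character chi.

Local Notation chiJ := (imchJ chiP).
Local Notation chiC := (imchC chiP).

(** Among all arrows of [s] between the pairs {i, k} and {j, l}, in either direction, the arrow from
    [i] to [j] is the only one. *)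
Definition isolated_arrow (s : 'S_n) (i k j l : 'I_n) : bool :=
  [&& uniq [:: i; k; j; l], s i == j, s k != l, s j != i, s j != k, s l != i & s l != k].

Let isolated_word d0 K W i k j l :
  class_val d0 chi (word_type K W) != 0 -> word_ok K W -> (K <= n)%N ->
  [&& uniq [:: i; k; j; l], all (fun z => z < K)%N [:: i; k; j; l],
      word_nat W i == j, word_nat W k != l, word_nat W j != i, word_nat W j != k,
      word_nat W l != i & word_nat W l != k] ->
  exists s i' k' j' l', chi s != 0 /\ isolated_arrow s i' k' j' l'.
Proof.
move=> X0 okW /exists_uniq_seq[s us ss] /andP[u /andP[lt rest]].
have lW : word_lt (size s) W by rewrite ss; case/and3P: okW => /and4P[].
have wE z := @word_permE _ d0 s W z us lW; have nu x y := @nth_uniq _ d0 s x y.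
rewrite ss in wE nu.
move: lt => /= /and5P[li lk lj ll _].
exists (word_perm d0 s W), (nth d0 s i), (nth d0 s k), (nth d0 s j), (nth d0 s l).
split; first by rewrite (class_val_word d0 chiJ okW us ss).
have [[wi ei] [wk ek]] := (wE i li, wE k lk).
have [[wj ej] [wl el]] := (wE j lj, wE l ll).
rewrite /isolated_arrow ei ek ej el !nu // rest andbT.
move: u; rewrite /= !inE !negb_or => /and4P[/and3P[? ? ?] /andP[? ?] ? _].
by rewrite !nu //; apply/and4P; split=> //; [apply/and3P | apply/andP].
Qed.

(** Cycles of length 3, 4 and 5 contain such an arrow, and for n at least 6 so do types (3,2) and
    (4,2). If chi vanished on all of these, the class identities would give [chi 1 = 0]. *)
Lemma exists_isolated_arrow :
  exists s i k j l, chi s != 0 /\ isolated_arrow s i k j l.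
Proof.
have d0 : 'I_n := Ordinal (leq_trans (isT : 0 < 5)%N n5).
pose X := class_val d0 chi.
have [X3|X3] := eqVneq (X [:: 3]%N) 0; last first.
  by apply: (@isolated_word d0 5 [:: (0, 1); (0, 2)] 0 3 1 4)%N.
have [X4|X4] := eqVneq (X [:: 4]%N) 0; last first.
  by apply: (@isolated_word d0 5 [:: (0, 1); (0, 2); (0, 3)] 0 3 1 4)%N.
have [X5|X5] := eqVneq (X [:: 5]%N) 0; last first.
  by apply: (@isolated_word d0 5 [:: (0, 1); (0, 2); (0, 3); (0, 4)] 0 4 1 2)%N.
have f0 : chi 1%g != 0 by rewrite gt_eqF // (imch_gt0 chiP).
have := class_identity2 d0 chiJ chiC (leq_trans (isT : 1 < 5)%N n5).
have := class_identity3 d0 chiJ chiC (leq_trans (isT : 2 < 5)%N n5).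
have := class_identity4 d0 chiJ chiC (leq_trans (isT : 3 < 5)%N n5).
have := class_identity32 d0 chiJ chiC n5.
rewrite -/X X3 X4 X5.
have [n6 | n6] := ltnP 5 n.
  have [X32|X32] := eqVneq (X [:: 3; 2]%N) 0; last first.
    by move=> *; apply: (@isolated_word d0 6 [:: (0, 1); (0, 2); (3, 4)] 0 3 1 5)%N.
  have [X42|X42] := eqVneq (X [:: 4; 2]%N) 0; last first.
    by move=> *; apply: (@isolated_word d0 6 [:: (0, 1); (0, 2); (0, 3); (4, 5)] 0 3 1 4)%N.
  rewrite X32 X42; move: (X [:: 2]%N) (X [:: 2; 2]%N) => x2 x22 _ e4 e3 e2.
  have x20 : x2 = 0 by apply: (mulIf f0); lra.
  have x220 : x22 = 0 by apply: (mulIf f0); lra.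
  by have /eqP[] := f0; apply: (mulIf f0); rewrite x20 x220 in e2; lra.
(* For n = 5 the factor [m - 5] removes the types with six or more points; the value on type (3,2)
   is then -3 times that on transpositions, and [e32] makes both vanish. *)
have -> : (n%:R : int) = 5%:R by congr _%:R; apply/eqP; rewrite eqn_leq n6.
move: (X [:: 2]%N) (X [:: 2; 2]%N) (X [:: 3; 2]%N) (X [:: 4; 2]%N) => x2 x22 x32 x42.
move: (X _) (X _) => x33 x322 e32 e4 e3 e2.
have x220 : x22 = 0 by apply: (mulIf f0); lra.
have x32E : x32 = - 3 * x2 by apply: (mulIf f0); lra.
have x20 : x2 = 0.
  by apply/eqP; rewrite -sqrf_eq0; apply/eqP; rewrite x220 x32E in e32; lra.
by have /eqP[] := f0; apply: (mulIf f0); rewrite x20 x220 in e2; lra.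
Qed.

Lemma exists_perm4 (i k j l i' k' j' l' : 'I_n) :
  uniq [:: i; k; j; l] -> uniq [:: i'; k'; j'; l'] ->
  exists g : 'S_n, [/\ g i = i', g k = k', g j = j' & g l = l'].
Proof.
move=> u u'; have [g [gi gk gj gl]] := exists_perm_map u u' erefl.
by exists g.
Qed.

Variables (F : fieldType) (c : 'I_n -> 'I_n -> F).
Hypothesis c_neq0 : forall i j, c i j != 0.
Hypothesis c_supp : forall s : 'S_n, chi s != 0 -> \prod_i c i (s i) = 1.

Let prodJ (s h : 'S_n) : chi s != 0 -> \prod_i c (h i) (h (s i)) = 1.
Proof.
move=> s0; rewrite -[RHS](c_supp (s := s ^ h)%g) ?chiJ //.
rewrite [RHS](reindex_inj (@perm_inj _ h)) /=.
by apply: eq_bigr => i _; rewrite permJ.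
Qed.

Let prod_c_eq (f g : 'I_n -> F) (i : 'I_n) :
  \prod_x f x = \prod_x g x -> (forall x, f x != 0) ->
  (forall x, x != i -> f x = g x) -> f i = g i.
Proof.
move=> e f0 fg; move: e; rewrite (bigD1 i) //= [RHS](bigD1 i) //=.
rewrite -(eq_bigr _ fg) => /mulIf; apply; apply/prodf_neq0 => x _; exact: f0.
Qed.

(** With h1 = (i k) and h2 = (j l), multiply the conditions for [s] and its conjugate by [h1 * h2],
    and compare with those for the conjugates by [h1] and by [h2]. An arrow fixed by one of the two
    swaps contributes equally to both sides, so only the isolated arrow remains. *)
Lemma cross_ratio i k j l : uniq [:: i; k; j; l] ->
  c i j * c k l = c i l * c k j.
Proof.
move=> u; have [s0 [i0 [k0 [j0 [l0 [s0_neq0 /and5P[u0 /eqP si sk sji /and3P[sjk sli slk]]]]]]]] :=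
  exists_isolated_arrow.
have [g [gi gk gj gl]] := exists_perm4 u0 u.
pose s := (s0 ^ g)%g.
have s_neq0 : chi s != 0 by rewrite chiJ.
have sE x : s (g x) = g (s0 x) by rewrite permJ.
have [] : [/\ s i = j, s k != l, s j != i, s j != k & (s l != i) && (s l != k)].
  by rewrite -gi -gk -gj -gl !sE !(inj_eq perm_inj) si; split => //; rewrite sli.
move=> {}si {}sk {}sji {}sjk /andP[{}sli {}slk].
move: u; rewrite /= !inE !negb_or => /and4P[/and3P[ik ij il] /andP[kj kl] jl _].
pose h1 := tperm i k; pose h2 := tperm j l.
have comm x : h2 (h1 x) = h1 (h2 x).
  have : (h1 * h2 = h2 * h1)%g.
    by rewrite conjgC tpermJ !(tpermD (x := j) (y := l)) // eq_sym.
  by move/permP/(_ x); rewrite !permM.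
have e : \prod_x (c x (s x) * c (h2 (h1 x)) (h2 (h1 (s x))))
       = \prod_x (c (h1 x) (h1 (s x)) * c (h2 x) (h2 (s x))).
  rewrite !big_split /= c_supp // !prodJ // mul1r mulr1.
  rewrite -[RHS](prodJ (h1 * h2)%g s_neq0); apply: eq_bigr => x _.
  by rewrite !permM.
have h1E y : y != i -> y != k -> h1 y = y.
  by move=> yi yk; apply: tpermD; rewrite eq_sym.
have h2E y : y != j -> y != l -> h2 y = y.
  by move=> yj yl; apply: tpermD; rewrite eq_sym.
have -> : c i j * c k l = c i (s i) * c (h2 (h1 i)) (h2 (h1 (s i))).
  by rewrite si /h1 tpermL (h1E j) 1?eq_sym // h2E // tpermL.
have -> : c i l * c k j = c (h1 i) (h1 (s i)) * c (h2 i) (h2 (s i)).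
  by rewrite si /h1 tpermL (h1E j) 1?eq_sym // h2E // /h2 tpermL mulrC.
apply: (prod_c_eq e) => //.
  by move=> x; rewrite mulf_neq0.
move=> x xi.
have fix1 : h1 x = x -> h1 (s x) = s x -> c x (s x) * c (h2 (h1 x)) (h2 (h1 (s x)))
    = c (h1 x) (h1 (s x)) * c (h2 x) (h2 (s x)) by move=> -> ->.
have fix2 : h2 x = x -> h2 (s x) = s x -> c x (s x) * c (h2 (h1 x)) (h2 (h1 (s x)))
    = c (h1 x) (h1 (s x)) * c (h2 x) (h2 (s x)).
  by rewrite !comm => -> ->; rewrite mulrC.
have sx_j : s x != j by rewrite -si (inj_eq perm_inj).
have [xk|xk] := eqVneq x k; first by apply: fix2; apply: h2E; rewrite // xk.
have [xj|xj] := eqVneq x j; first by apply: fix1; apply: h1E; rewrite xj // eq_sym.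
have [xl|xl] := eqVneq x l; first by apply: fix1; apply: h1E; rewrite xl // eq_sym.
have [sxi|sxi] := eqVneq (s x) i.
  by apply: fix2; apply: h2E; rewrite ?sxi.
have [sxk|sxk] := eqVneq (s x) k.
  by apply: fix2; apply: h2E; rewrite ?sxk.
by apply: fix1; apply: h1E.
Qed.

Lemma offdiag_rank1 : exists a b : 'I_n -> F,
  [/\ forall i, a i != 0, forall i, b i != 0 &
      forall i j, i != j -> c i j = a i * b j].
Proof.
have [s us ss] := exists_uniq_seq n5.
case: s us ss => [|z [|x [|y [|w [|v [|]]]]]] //= us _.
move: us; rewrite !inE !negb_or => /and5P[/and4P[zx zy zw _] /and3P[xy xw _] /andP[yw _] _ _].
have [xz yz wz] : [/\ x != z, y != z & w != z] by rewrite ![_ == z]eq_sym.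
(* The entry at (z, z) that a rank one array would have, predicted from row [i] and column [j]. The
   true diagonal entry is not yet controlled, so this value, shown to be independent of [i] and [j],
   defines [a z]. *)
pose T i j := c z j * c i z / c i j.
have Tj i j j' : i != z -> j != z -> j' != z -> i != j -> i != j' -> T i j = T i j'.
  move=> iz jz j'z ij ij'; have [->//|jj'] := eqVneq j j'.
  have e : c z j * c i j' = c z j' * c i j.
    apply: cross_ratio; rewrite /= !inE !negb_or ij ij' jj' andbT.
    by rewrite ![z == _]eq_sym iz jz j'z.
  by apply/eqP; rewrite eqr_div // mulrAC e mulrAC.
have Ti i i' j : i != z -> i' != z -> j != z -> i != j -> i' != j -> T i j = T i' j.
  move=> iz i'z jz ij i'j; have [->//|ii'] := eqVneq i i'.
  have e : c i z * c i' j = c i j * c i' z.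
    apply: cross_ratio; rewrite /= !inE !negb_or ij ii' iz i'j i'z andbT.
    by rewrite eq_sym jz.
  apply/eqP; rewrite eqr_div //; apply/eqP.
  by rewrite -mulrA e -mulrA [c i j * _]mulrC.
have TT i j : i != z -> j != z -> i != j -> T i j = T x y.
  move=> iz jz ij; have [jx|jx] := eqVneq x j; last first.
    by rewrite (Ti i x) // (Tj x j y).
  have [iy|iy] := eqVneq y i; last first.
    have iy' : i != y by rewrite eq_sym.
    by rewrite (Tj i j y) // (Ti i x).
  have [wx wy yx] : [/\ w != x, w != y & y != x] by rewrite ![_ == x]eq_sym [w == y]eq_sym.
  by rewrite -jx -iy (Ti y w x) // (Tj w x y) // (Ti w x y).
pose a i := if i == z then T x y else c i z.
have a_neq0 i : a i != 0.
  rewrite /a; case: ifP => _ //; by rewrite /T !mulf_neq0 ?invr_neq0.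
have key i i' j : i != j -> i' != j -> c i j * a i' = c i' j * a i.
  move=> ij i'j; have [->//|ii'] := eqVneq i i'.
  rewrite /a; case: (eqVneq i z) => [iz|iz]; case: (eqVneq i' z) => [i'z|i'z].
  - by rewrite iz i'z eqxx in ii'.
  - rewrite iz -(TT i' j) // -?iz 1?eq_sym // /T mulrC [RHS]mulrC divfK // iz.
    by rewrite mulrC.
  - by rewrite i'z -(TT i j) // -?i'z 1?eq_sym // /T mulrC divfK // i'z.
  have [->|jz] := eqVneq j z; first by rewrite mulrC.
  by rewrite [LHS]cross_ratio 1?mulrC //= !inE !negb_or ii' ij iz i'j i'z jz.
pose o j := if j == x then y else x.
have oj j : o j != j by rewrite /o; case: (eqVneq j x) => [->|]; rewrite eq_sym.
exists a, (fun j => c (o j) j / a (o j)); split=> // [i|i j ij].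
  by rewrite mulf_neq0 ?invr_neq0.
apply: (mulIf (a_neq0 (o j))); rewrite (key _ _ _ ij (oj j)).
by rewrite mulrA divfK // mulrC.
Qed.

(** Let [D i] be the ratio of the diagonal entry to its rank one prediction. The condition on [s]
    becomes [K] times the product of [D] over the fixed points of [s]. Swapping a fixed and a moved
    point by conjugation shows that [D] is constant; comparison with the identity gives
    [D ^+ moved s = 1], hence [D = 1]. *)
Lemma support_torus : exists a b : 'I_n -> F,
  [/\ forall i, a i != 0, forall i, b i != 0, \prod_i a i * \prod_i b i = 1 &
      forall i j, c i j = a i * b j].
Proof.
have [a [b [a0 b0 cE]]] := offdiag_rank1.
pose D i := c i i / (a i * b i).
have D0 i : D i != 0 by rewrite !mulf_neq0 ?invr_neq0 ?mulf_neq0.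
pose N (s : 'S_n) := \prod_i (if s i == i then D i else 1).
pose K := \prod_i a i * \prod_i b i.
have cK (s : 'S_n) : chi s != 0 -> K * N s = 1.
  move=> /c_supp <-; rewrite /K [X in _ * X * _](reindex_inj (@perm_inj _ s)) /=.
  rewrite -!big_split; apply: eq_bigr => i _ /=.
  case: eqVneq => [->|si]; first by rewrite mulrC divfK // mulf_neq0.
  by rewrite mulr1 cE // eq_sym.
have K0 : K != 0 by rewrite mulf_neq0 //; apply/prodf_neq0.
have [d0] : exists d0 : 'I_n, true by exists (Ordinal (leq_trans (isT : 0 < 5)%N n5)).
have [s0 [s0d s01 s0_neq0]] := exists_fixed_support n5 (imch_gt0 chiP) (imch_norm chiP) (imch_dvd chiP) d0.
have [y0 s0y] : exists y, s0 y != y.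
  apply/existsP; apply: contraNT s01; rewrite negb_exists => /forallP id0.
  by apply/eqP/permP=> y; rewrite perm1; apply/eqP; have := id0 y; rewrite negbK.
have D_const i k : D i = D k.
  have [->//|ik] := eqVneq i k.
  have [||//|g [gi gk]] := @exists_perm_map _ [:: d0; y0] [:: i; k].
  - by rewrite /= inE andbT; apply: contraNneq s0y => <-; rewrite s0d.
  - by rewrite /= inE andbT.
  pose s := (s0 ^ g)%g.
  have s_neq0 : chi s != 0 by rewrite chiJ.
  have si : s i = i by rewrite -gi permJ s0d.
  have sk : s k != k by rewrite -gk permJ (inj_eq perm_inj).
  have s_neq0' : chi (s ^ tperm i k)%g != 0 by rewrite chiJ.
  have := etrans (cK _ s_neq0) (esym (cK _ s_neq0')) => /(mulfI K0).
  rewrite /N [RHS](reindex_inj (@perm_inj _ (tperm i k))) /=.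
  under [RHS]eq_bigr => y _ do rewrite permJ (inj_eq perm_inj).
  move=> e; have := prod_c_eq (i := i) e; rewrite si eqxx tpermL; apply.
    by move=> y; case: ifP; rewrite ?oner_neq0.
  move=> y yi; have [->|yk] := eqVneq y k; first by rewrite (negbTE sk).
  by rewrite tpermD // eq_sym.
have NE s : N s = D d0 ^+ #|[set i | s i == i]|.
  rewrite /N -big_mkcond -(eq_bigr _ (fun i _ => D_const d0 i)) prodr_const.
  by congr (_ ^+ _); apply: eq_card => i; rewrite inE.
have D1 : D d0 = 1.
  apply: (moved_exp_eq1 n5 chiJ chiC (imch_gt0 chiP) (imch_norm chiP) (imch_dvd chiP)) => s s0'.
  have N1 : chi 1%g != 0 by rewrite gt_eqF // (imch_gt0 chiP).
  have := etrans (cK _ N1) (esym (cK _ s0')) => /(mulfI K0); rewrite !NE.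
  have -> : #|[set i | (1 : 'S_n)%g i == i]| = (#|[set i | s i == i]| + moved s)%N.
    transitivity #|'I_n|.
      by apply: eq_card => i; rewrite !inE perm1 eqxx.
    rewrite -(cardsC [set i | s i == i]); congr addn.
    by apply: eq_card => i; rewrite !inE.
  rewrite exprD => e.
  exact: (mulfI (expf_neq0 _ (D0 d0)) (etrans e (esym (mulr1 _)))).
exists a, b; split=> // [|i j].
  have N1 : chi 1%g != 0 by rewrite gt_eqF // (imch_gt0 chiP).
  by rewrite -/K -(cK _ N1) NE D1 expr1n mulr1.
have [<-|/cE//] := eqVneq i j.
have := D_const i d0; rewrite D1 /D => /(congr1 ( *%R^~ (a i * b i))).
by rewrite divfK ?mul1r // mulf_neq0.
Qed.

End SupportTorus.

Lemma exists_notin (T : finType) (l : seq T) :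
  (size l < #|T|)%N -> exists x, x \notin l.
Proof.
move=> lt_l; apply/existsP; apply: contraLR lt_l; rewrite negb_exists -leqNgt.
move=> /forallP in_l; apply: leq_trans (card_size l).
by apply: subset_leq_card; apply/subsetP=> x _; have := in_l x; rewrite negbK.
Qed.

(** * The linear relation that rules out coefficients within a line *)

Section RowOperators.

Variables (n : nat) (chi : 'S_n -> int).
Hypothesis n5 : (5 <= n)%N.
Hypothesis chiP : immanant_character chi.
Local Notation chiJ := (imchJ chiP).

Lemma exists_moving_support (x y : 'I_n) : x != y ->
  exists s : 'S_n, [/\ s x = x, s y != y & chi s != 0].
Proof.
move=> xy; have d0 := x.
have [s [sd s1 s0]] := exists_fixed_support n5 (imch_gt0 chiP) (imch_norm chiP) (imch_dvd chiP) d0.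
have [e se] : exists e, s e != e.
  apply/existsP; apply: contraNT s1; rewrite negb_exists => /forallP id0.
  by apply/eqP/permP=> e; rewrite perm1; apply/eqP; have := id0 e; rewrite negbK.
have [||//|g [gd ge]] := @exists_perm_map _ [:: d0; e] [:: x; y].
- by rewrite /= inE andbT; apply: contraNneq se => <-; rewrite sd.
- by rewrite /= inE andbT.
exists (s ^ g)%g; rewrite chiJ; split=> //; first by rewrite -gd permJ sd.
by rewrite -ge permJ (inj_eq perm_inj).
Qed.

Lemma exists_arrow_support (x y : 'I_n) : x != y ->
  exists s : 'S_n, s x = y /\ chi s != 0.
Proof.
move=> xy; have [s [_ sy s0]] := exists_moving_support xy.
have [||//|g [gy gsy]] := @exists_perm_map _ [:: y; s y] [:: x; y].
- by rewrite /= inE andbT eq_sym.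
- by rewrite /= inE andbT.
by exists (s ^ g)%g; rewrite chiJ -{1}gy permJ gsy.
Qed.

Variable F : numFieldType.
Local Notation chiF s := ((chi s)%:~R : F).

Let chiF_neq0 s : (chiF s != 0) = (chi s != 0).
Proof. by rewrite intr_eq0. Qed.

(** [A] is constant off {i, k}. If it vanishes there, it vanishes everywhere; otherwise no [A j] is
    0, and the relation shows that left multiplication by (i k) preserves the support. By
    conjugation so does every transposition, and starting from 1 the support would contain all
    permutations. *)
Lemma row_operator_eq0 (i k : 'I_n) (A : 'I_n -> F) : i != k ->
  (forall s : 'S_n, A (s i) * chiF s + A (s k) * chiF (tperm i k * s)%g = 0) ->
  forall j, A j = 0.
Proof.
move=> ik hA.
have chi0 (a : F) s : a != 0 -> a * chiF s = 0 -> chi s = 0.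
  by move=> a0 /eqP; rewrite mulf_eq0 (negbTE a0) intr_eq0 => /eqP.
(* Conjugation by (p q) fixes [i] and [k]. When [s] sends [i] to [p] and does not send [k] to [q],
   it changes only the coefficient in the first term, so subtraction gives
   [(A p - A q) * chiF s = 0]. *)
have A_const p q : p != i -> p != k -> q != i -> q != k -> A p = A q.
  move=> pi pk qi qk; apply/eqP; apply/negPn/negP => Apq.
  have pq : p != q by apply: contraNneq Apq => ->.
  have vanish (s : 'S_n) : s i = p -> s k != q -> chi s = 0.
    move=> si sk; apply: (chi0 (A p - A q)); first by rewrite subr_eq0.
    pose t := tperm p q.
    have [ti tk] : t i = i /\ t k = k by rewrite !tpermD.
    have sti : (s ^ t)%g i = q by rewrite -{1}ti permJ si tpermL.
    have skp : s k != p by rewrite -si (inj_eq perm_inj) eq_sym.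
    have stk : (s ^ t)%g k = s k by rewrite -{1}tk permJ tpermD // eq_sym.
    have stt : (tperm i k * s ^ t)%g = ((tperm i k * s) ^ t)%g by rewrite conjMg tpermJ ti tk.
    have := hA (s ^ t)%g; rewrite sti stk stt !chiJ -{1}(hA s) si => /addIr/eqP.
    by rewrite eq_sym -subr_eq0 -mulrBl => /eqP.
  have [s [_ ss s0]] := exists_moving_support ik.
  have [k' k'P] : exists k', k' \notin [:: k; s k] by apply: exists_notin; rewrite card_ord /=; lia.
  have [q' q'P] : exists q', q' \notin [:: k; s k; k'; s k'] by apply: exists_notin; rewrite card_ord /=; lia.
  move: k'P q'P; rewrite !inE !negb_or => /andP[k'k k'sk] /and4P[q'k q'sk q'k' q'sk'].
  have [||g [gk gk' gsk gq']] := @exists_perm4 _ k k' (s k) q' i k p q.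
  - by rewrite /= !inE !negb_or ![k == _]eq_sym ss k'k q'k k'sk [k' == q']eq_sym q'k' [s k == _]eq_sym q'sk.
  - by rewrite /= !inE !negb_or ik ![i == _]eq_sym pi qi ![k == _]eq_sym pk qk pq.
  have sgi : (s ^ g)%g i = p by rewrite -gk permJ.
  have sgk : (s ^ g)%g k != q by rewrite -gk' permJ -gq' (inj_eq perm_inj) eq_sym.
  by have := vanish _ sgi sgk; rewrite chiJ => /eqP; rewrite (negbTE s0).
have [p] : exists p, p \notin [:: i; k] by apply: exists_notin; rewrite card_ord /=; lia.
rewrite !inE negb_or => /andP[pi pk].
have Az j : j != i -> j != k -> A j = A p by move=> ji jk; apply: A_const.
have [s1 [s1i s1k s1_neq0]] := exists_moving_support ik.
have [s2 [s2k s2i s2_neq0]] : exists s : 'S_n, [/\ s k = k, s i != i & chi s != 0].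
  by apply: exists_moving_support; rewrite eq_sym.
have s1ki : s1 k != i by rewrite -[X in _ != X]s1i (inj_eq perm_inj) eq_sym.
have s2ik : s2 i != k by rewrite -[X in _ != X]s2k (inj_eq perm_inj).
have chiF0 s : chi s != 0 -> chiF s == 0 = false by rewrite -chiF_neq0 => /negbTE.
have [z0|z0] := eqVneq (A p) 0.
  have x0 : A i = 0.
    apply/eqP; have := hA s1; rewrite s1i (Az (s1 k)) // z0 mul0r addr0 => /eqP.
    by rewrite mulf_eq0 chiF0 // orbF.
  have [s [si s0]] := exists_arrow_support ik.
  have sk : s k != k by rewrite -[X in _ != X]si (inj_eq perm_inj) eq_sym.
  have Ask : A (s k) = 0 by have [->//|ski] := eqVneq (s k) i; rewrite Az.
  have y0 : A k = 0.
    apply/eqP; have := hA s; rewrite si Ask mul0r addr0 => /eqP.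
    by rewrite mulf_eq0 chiF0 // orbF.
  by move=> j; have [->//|ji] := eqVneq j i; have [->//|jk] := eqVneq j k; rewrite Az.
have h2 := hA s2; rewrite s2k (Az (s2 i)) // in h2.
have y0 : A k != 0.
  apply/eqP => y0; move: h2; rewrite y0 mul0r addr0 => /eqP.
  by rewrite mulf_eq0 (negbTE z0) chiF0.
have x0 : A i != 0.
  apply/eqP => x0; pose s := (s2 ^ tperm i k)%g.
  have sE y : s (tperm i k y) = tperm i k (s2 y) by rewrite permJ.
  have si : s i = i by have := sE k; rewrite s2k !tpermR.
  have t2 : tperm i k (s2 i) = s2 i by apply: tpermD; rewrite eq_sym.
  have sk : s k = s2 i by have := sE i; rewrite tpermL t2.
  have ts : (tperm i k * s)%g = ((tperm i k * s2) ^ tperm i k)%g.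
    by rewrite conjMg tpermJ tpermL tpermR (tpermC k i).
  have := hA s; rewrite si sk x0 mul0r add0r (Az (s2 i)) // => /(chi0 _ _ z0).
  rewrite ts chiJ => e; move: h2; rewrite e mulr0 addr0 => /eqP.
  by rewrite mulf_eq0 (negbTE z0) chiF0.
have A0 j : A j != 0.
  by have [->//|ji] := eqVneq j i; have [->//|jk] := eqVneq j k; rewrite Az.
have step s : chi s != 0 -> chi (tperm i k * s)%g != 0.
  move=> s0; apply/eqP => e; have := hA s; rewrite e mulr0 addr0 => /eqP.
  by rewrite mulf_eq0 (negbTE (A0 _)) chiF0.
have step' u v s : u != v -> chi s != 0 -> chi (tperm u v * s)%g != 0.
  move=> uv s0; have [||//|g [gi gk]] := @exists_perm_map _ [:: i; k] [:: u; v];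
    rewrite /= ?inE ?andbT //.
  rewrite -gi -gk -tpermJ -(conjgKV g s) -conjMg chiJ; apply: step.
  by rewrite chiJ.
have [s sz] := imch_zero chiP.
have [ts sE /allP dts] := prod_tpermP s.
have : chi s != 0; last by rewrite sz eqxx.
rewrite {}sE; elim: ts dts => [|t ts IHts] dts.
  by rewrite big_nil gt_eqF // (imch_gt0 chiP).
rewrite big_cons; apply: step'; first by apply: (dts t); rewrite mem_head.
by apply: IHts => u uts; apply: dts; rewrite inE uts orbT.
Qed.

End RowOperators.

(** * Directional derivatives and killing endomorphisms *)

Lemma poly_eq_horner (F : numFieldType) (p q : {poly F}) :
  (forall t, p.[t] = q.[t]) -> p = q.
Proof.
move=> pq; apply/eqP; rewrite -subr_eq0; apply/negPn/negP => nz.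
pose rs : seq F := [seq i%:R | i <- iota 0 (size (p - q))].
have urs : uniq rs.
  by rewrite map_inj_uniq ?iota_uniq // => i j /eqP; rewrite eqr_nat => /eqP.
have rrs : all (root (p - q)) rs.
  by apply/allP => t _; rewrite rootE !hornerE pq subrr.
by have := max_poly_roots nz rrs urs; rewrite size_map size_iota ltnn.
Qed.

Lemma coef01_prod_affine (F : comNzRingType) (I : eqType) (r : seq I) (a b : I -> F) :
  uniq r ->
  (\prod_(i <- r) ((a i)%:P + b i *: 'X))`_0 = \prod_(i <- r) a i /\
  (\prod_(i <- r) ((a i)%:P + b i *: 'X))`_1
    = \sum_(k <- r) b k * \prod_(i <- r | i != k) a i.
Proof.
elim: r => [|x r IHr] /=; first by rewrite !big_nil !coef1.
case/andP=> xr /IHr [e0 e1]; rewrite !big_cons.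
have c0 : ((a x)%:P + b x *: 'X)`_0 = a x by rewrite coefD coefC coefZ coefX mulr0 addr0.
have c1 : ((a x)%:P + b x *: 'X)`_1 = b x by rewrite coefD coefC coefZ coefX mulr1 add0r.
split; first by rewrite coefM big_ord1 c0 e0.
rewrite coefM big_ord_recl big_ord1 /= c0 c1 e0 e1 /= addrC eqxx /=; congr (_ * _ + _).
  rewrite big_seq [RHS]big_seq_cond; apply: eq_bigl => i.
  by rewrite andb_idr // => ir; apply: contraNneq xr => <-.
rewrite mulr_sumr; apply: eq_big_seq => k kr.
rewrite big_cons ifT; first by rewrite mulrCA.
by apply: contraNneq xr => ->.
Qed.

Lemma perm_eq_off (T : finType) (i : T) (s s' : {perm T}) :
  (forall p, p != i -> s p = s' p) -> s = s'.
Proof.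
move=> eq_p; apply/permP => p; have [->|] := eqVneq p i; last exact: eq_p.
pose x := (s'^-1 (s i))%g; have sx : s' x = s i by rewrite permKV.
have [xi|xi] := eqVneq x i; first by rewrite -sx xi.
by case/eqP: (xi); apply: (@perm_inj _ s); rewrite eq_p.
Qed.

Section Derivative.

Variables (F : numFieldType) (n : nat) (chi : 'S_n -> int).

Local Notation chiF s := ((chi s)%:~R : F).

Definition imm (X : 'M[F]_n) : F := \sum_(s : 'S_n) chiF s * \prod_i X i (s i).

Definition imm_deriv (X Y : 'M[F]_n) : F :=
  \sum_(s : 'S_n) chiF s * \sum_k Y k (s k) * \prod_(i | i != k) X i (s i).

Let line (X Y : 'M[F]_n) : {poly F} :=
  \sum_(s : 'S_n) chiF s *: \prod_i ((X i (s i))%:P + Y i (s i) *: 'X).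

Let line_horner X Y t : (line X Y).[t] = imm (X + t *: Y).
Proof.
rewrite /line horner_sum; apply: eq_bigr => s _; rewrite hornerZ horner_prod.
by congr (_ * _); apply: eq_bigr => i _; rewrite !hornerE !mxE mulrC.
Qed.

Let line_coef1 X Y : (line X Y)`_1 = imm_deriv X Y.
Proof.
rewrite /line coef_sum; apply: eq_bigr => s _; rewrite coefZ; congr (_ * _).
by have [_ ->] := coef01_prod_affine (fun i => X i (s i)) (fun i => Y i (s i)) (index_enum_uniq _).
Qed.

(** The derivative is the linear coefficient of the polynomial [imm (X + t *: Y)] in [t], and [g]
    preserves its value at every [t] of an infinite field. *)
Lemma imm_deriv_comp (g : 'M[F]_n -> 'M[F]_n) :
  (forall a X Y, g (a *: X + Y) = a *: g X + g Y) ->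
  (forall X, imm (g X) = imm X) ->
  forall X Y, imm_deriv (g X) (g Y) = imm_deriv X Y.
Proof.
move=> g_lin gP X Y; rewrite -!line_coef1.
suff -> : line (g X) (g Y) = line X Y by [].
apply: poly_eq_horner => t; rewrite !line_horner -(gP (X + _)).
by rewrite addrC -g_lin addrC.
Qed.

Lemma imm_deriv_row0 (X Y : 'M[F]_n) (i : 'I_n) : (forall j, X i j = 0) ->
  imm_deriv X Y = \sum_(s : 'S_n) chiF s * (Y i (s i) * \prod_(p | p != i) X p (s p)).
Proof.
move=> X0; apply: eq_bigr => s _; congr (_ * _).
rewrite (bigD1 i) //= [X in _ + X]big1 ?addr0 // => k ki.
by rewrite (bigD1 i) 1?eq_sym //= X0 mul0r mulr0.
Qed.

Hypothesis n5 : (5 <= n)%N.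
Hypothesis chiP : immanant_character chi.
Local Notation chiJ := (imchJ chiP).

Lemma imm_deriv_tr X Y : imm_deriv X^T Y^T = imm_deriv X Y.
Proof.
rewrite /imm_deriv (reindex_inj invg_inj) /=; apply: eq_bigr => s _.
rewrite imchV //; congr (_ * _); rewrite (reindex_inj (@perm_inj _ s)) /=.
apply: eq_bigr => k _; rewrite mxE permK; congr (_ * _).
rewrite (reindex_inj (@perm_inj _ s)) /=; apply: eq_big => [i|i _].
  by rewrite (inj_eq perm_inj).
by rewrite mxE permK.
Qed.

Section Killing.

Variable A : 'M[F]_n -> 'M[F]_n.
Hypothesis A_add : forall X Y, A (X + Y) = A X + A Y.
Hypothesis A_kill : forall X, imm_deriv X (A X) = 0.

(** Emptying row [i] in the graph of [s], where [s i = j], leaves only the term of [s] in the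
    derivative, with and without an extra entry at (k, l). Additivity isolates that entry; if
    [s k = l] it turns a 1 into a 2, still nonzero. *)
Lemma killing_neq (i j k l : 'I_n) : i != k -> j != l ->
  A (delta_mx k l) i j = 0.
Proof.
move=> ik jl.
have [s [si s0]] : exists s : 'S_n, s i = j /\ chi s != 0.
  have [->|ij] := eqVneq i j; last exact: (exists_arrow_support n5 chiP ij).
  by exists 1%g; rewrite perm1 gt_eqF // (imch_gt0 chiP).
have entry0 (X : 'M[F]_n) : (forall q, X i q = 0) ->
    (forall p q, p != i -> p != k -> X p q = (q == s p)%:R) ->
    (forall q, q != l -> X k q = (q == s k)%:R) -> X k (s k) != 0 ->
    A X i j = 0.
  move=> Xi Xp Xk Xks; have := A_kill X; rewrite (imm_deriv_row0 _ Xi).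
  rewrite (bigD1 s) //= [X in _ + X]big1 ?addr0 => [|s' s's]; last first.
    apply/eqP; rewrite !mulf_eq0; apply/orP; right; apply/orP; right.
    apply/negPn/negP => /prodf_neq0 nz.
    have eq_p p : p != i -> p != k -> s' p = s p.
      move=> pi pk; have := nz p pi; rewrite Xp // pnatr_eq0 eqb0 negbK.
      by move/eqP.
    case/eqP: s's; apply: (@perm_eq_off _ i) => p pi.
    have [->|pk] := eqVneq p k; last exact: eq_p.
    have := nz k; rewrite eq_sym => /(_ ik).
    have [s'k _|s'kl] := eqVneq (s' k) l; last first.
      by rewrite Xk // pnatr_eq0 eqb0 negbK => /eqP.
    (* Using the entry (k, l) would hit column [l] twice, since row [x] already uses it, unless [x]
       is [k]. *)
    pose x := (s^-1 l)%g; have sx : s x = l by rewrite permKV.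
    have xi : x != i by apply: contraNneq jl => xi; rewrite -si -xi sx.
    have [xk|xk] := eqVneq x k; first by rewrite s'k -sx xk.
    by case/eqP: (xk); apply: (@perm_inj _ s'); rewrite eq_p // sx s'k.
  rewrite si => /eqP; rewrite !mulf_eq0 intr_eq0 (negbTE s0) /=.
  case/orP=> [/eqP//|/prodf_eq0[p pi]].
  have [->|pk] := eqVneq p k; first by rewrite (negbTE Xks).
  by rewrite Xp // eqxx oner_eq0.
pose X0 : 'M[F]_n := \matrix_(p, q) ((p != i) && (q == s p))%:R.
have A0 : A X0 i j = 0.
  apply: entry0 => [q|p q pi pk|q ql|]; rewrite !mxE ?eqxx ?pi //=.
    by rewrite [k == i]eq_sym ik.
  by rewrite [k == i]eq_sym ik oner_eq0.
have : A (X0 + delta_mx k l) i j = 0.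
  apply: entry0 => [q|p q pi pk|q ql|]; rewrite !mxE ?eqxx ?pi //=.
  - by rewrite (negbTE ik) addr0.
  - by rewrite (negbTE pk) addr0.
  - by rewrite (negbTE ql) addr0 [k == i]eq_sym ik.
  by rewrite [k == i]eq_sym ik -natrD pnatr_eq0.
by rewrite A_add mxE A0 add0r.
Qed.

(** In the graph of [s], empty row [i] and add to row [k] a second entry, in column [s i]. Exactly
    [s] and [tperm i k * s] survive in the derivative, and their sum is the relation of
    [row_operator_eq0]. *)
Lemma killing_row (i k j : 'I_n) : i != k -> A (delta_mx k j) i j = 0.
Proof.
move=> ik; apply: (row_operator_eq0 n5 chiP (F := F) (A := fun j => A (delta_mx k j) i j) ik).
move=> s; pose Z : 'M[F]_n := \sum_(p | (p != i) && (p != k)) delta_mx p (s p).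
have A0 : A 0 = 0 by apply: (addrI (A 0)); rewrite -A_add !addr0.
have Z_entry q : A Z i q = \sum_(p | (p != i) && (p != k)) A (delta_mx p (s p)) i q.
  rewrite /Z (big_morph A (id1 := 0) (op1 := +%R)) // summxE.
  by apply: eq_bigr.
pose X := Z + (delta_mx k (s k) + delta_mx k (s i)).
have ski : s k != s i by rewrite (inj_eq perm_inj) eq_sym.
have AXi : A X i (s i) = A (delta_mx k (s i)) i (s i).
  rewrite !A_add !mxE Z_entry big1 => [|p /andP[pi pk]]; last first.
    by rewrite killing_neq 1?eq_sym // (inj_eq perm_inj).
  have sik : s i != s k by rewrite eq_sym.
  by rewrite add0r (killing_neq ik sik) add0r.
have AXk : A X i (s k) = A (delta_mx k (s k)) i (s k).
  rewrite !A_add !mxE Z_entry big1 => [|p /andP[pi pk]]; last first.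
    by rewrite killing_neq 1?eq_sym // (inj_eq perm_inj).
  by rewrite add0r (killing_neq ik ski) addr0.
have XE p q : X p q = ((p != i) && (p != k) && (q == s p))%:R
    + ((p == k) && (q == s k))%:R + ((p == k) && (q == s i))%:R.
  rewrite !mxE addrA; congr (_ + _ + _); rewrite /Z summxE.
  have [pik|pik] := boolP ((p != i) && (p != k)); last first.
    rewrite big1 // => r rik; rewrite mxE; case: eqP => // pr.
    by rewrite pr rik in pik.
  rewrite (bigD1 p) //= mxE eqxx big1 ?addr0 // => r /andP[_ rp].
  by rewrite mxE eq_sym (negbTE rp).
have Xi q : X i q = 0 by rewrite XE eqxx (negbTE ik) !addr0.
have := A_kill X; rewrite (imm_deriv_row0 _ Xi).
pose t := (tperm i k * s)%g.
have [ti tk] : t i = s k /\ t k = s i by rewrite !permM tpermL tpermR.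
have tp p : p != i -> p != k -> t p = s p.
  by move=> pi pk; rewrite permM tpermD // eq_sym.
have ts : t != s by apply: contraNneq ski => ts; rewrite -ti ts.
rewrite (bigD1 s) //= (bigD1 t) //= [X in _ + (_ + X)]big1 ?addr0 => [|s' /andP[s's s't]]; last first.
  apply/eqP; rewrite !mulf_eq0; apply/orP; right; apply/orP; right.
  apply/negPn/negP => /prodf_neq0 nz.
  have eq_p p : p != i -> p != k -> s' p = s p.
    move=> pi pk; have := nz p pi; rewrite XE pi pk (negbTE pk) !addr0 pnatr_eq0 eqb0 negbK.
    by move/eqP.
  have := nz k; rewrite eq_sym XE eqxx andbF add0r => /(_ ik).
  have [s'k _|s'k] := eqVneq (s' k) (s k).
    by case/eqP: s's; apply: (@perm_eq_off _ i) => p pi; have [->//|pk] := eqVneq p k; apply: eq_p.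
  have [s'i _|s'i] := eqVneq (s' k) (s i); last by rewrite addr0 eqxx.
  case/eqP: s't; apply: (@perm_eq_off _ i) => p pi.
  by have [->|pk] := eqVneq p k; rewrite ?tk // tp // eq_p.
have prod1 (u : 'S_n) : (forall p, p != i -> p != k -> u p = s p) -> u k = s k \/ u k = s i ->
    \prod_(p | p != i) X p (u p) = 1.
  move=> up uk; rewrite big1 // => p pi; rewrite XE pi /=.
  have [->|pk] := eqVneq p k; last by rewrite up // eqxx !addr0.
  by case: uk => ->; rewrite ?eqxx /= ?[s i == _]eq_sym (negbTE ski) ?addr0 ?add0r.
rewrite (prod1 s) //; last by left.
rewrite (prod1 t) //; last by right.
by rewrite ti AXi AXk !mulr1 mulrC [X in _ + X]mulrC.
Qed.

End Killing.

Lemma killing_diag (A : 'M[F]_n -> 'M[F]_n) :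
  (forall X Y, A (X + Y) = A X + A Y) ->
  (forall X, imm_deriv X (A X) = 0) ->
  forall i j k l, (i, j) != (k, l) -> A (delta_mx k l) i j = 0.
Proof.
move=> A_add A_kill i j k l; rewrite xpair_eqE negb_and.
have [->|ik _] := eqVneq i k; last first.
  have [->|jl] := eqVneq j l; first exact: killing_row.
  exact: killing_neq.
move=> /= jl; pose A' X := (A X^T)^T.
have A'_add X Y : A' (X + Y) = A' X + A' Y by rewrite /A' !linearD /= A_add linearD.
have A'_kill X : imm_deriv X (A' X) = 0 by rewrite -imm_deriv_tr /A' trmxK A_kill.
have := killing_row A'_add A'_kill k jl.
by rewrite /A' trmx_delta mxE.
Qed.

End Derivative.

(** * Permutations of cells and translations of the support *)

(** At each cell a coordinate of [phi] is constant along the whole row or the whole column. By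
    injectivity the two coordinates cannot both be constant on one line, so a single row with
    varying first coordinate forces the transposed pattern everywhere. *)
Lemma cell_perm_structure (T : finType) (phi : T * T -> T * T) :
  injective phi ->
  (forall i k j l, (phi (i, j)).1 = (phi (i, l)).1 \/ (phi (i, j)).1 = (phi (k, j)).1) ->
  (forall i k j l, (phi (i, j)).2 = (phi (i, l)).2 \/ (phi (i, j)).2 = (phi (k, j)).2) ->
  (1 < #|T|)%N ->
  exists a b : {perm T}, (forall i j, phi (i, j) = (a i, b j)) \/
                         (forall i j, phi (i, j) = (b j, a i)).
Proof.
move=> phi_inj fP hP T1.
have other (x : T) : exists y, y != x.
  have [y] : exists y, y \notin [:: x] by apply: exists_notin.
  by rewrite inE; exists y.
have row_ne i j l : j != l -> (phi (i, j)).1 = (phi (i, l)).1 -> (phi (i, j)).2 != (phi (i, l)).2.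
  move=> jl e1; apply: contra_neq jl => e2.
  by have /phi_inj[] : phi (i, j) = phi (i, l) by rewrite [LHS]surjective_pairing e1 e2 -surjective_pairing.
have col_ne i k j : i != k -> (phi (i, j)).1 = (phi (k, j)).1 -> (phi (i, j)).2 != (phi (k, j)).2.
  move=> ik e1; apply: contra_neq ik => e2.
  by have /phi_inj[] : phi (i, j) = phi (k, j) by rewrite [LHS]surjective_pairing e1 e2 -surjective_pairing.
have [/forallP all_row|] := boolP [forall i, forall j, forall l, (phi (i, j)).1 == (phi (i, l)).1].
  have fE i j l : (phi (i, j)).1 = (phi (i, l)).1.
    by have /forallP/(_ j)/forallP/(_ l)/eqP := all_row i.
  have hE i k j : (phi (i, j)).2 = (phi (k, j)).2.
    have [l lj] := other j; case: (hP i k j l) => // e.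
    by have := row_ne i l j lj (fE _ _ _); rewrite e eqxx.
  have [x0 _] : exists x0 : T, true by case/card_gt0P: (ltnW T1) => x0 _; exists x0.
  have a_inj : injective (fun i => (phi (i, x0)).1).
    move=> i k e; have /phi_inj[] // : phi (i, x0) = phi (k, x0).
    by rewrite [LHS]surjective_pairing e (hE i k) -surjective_pairing.
  have b_inj : injective (fun j => (phi (x0, j)).2).
    move=> j l e; have /phi_inj[] // : phi (x0, j) = phi (x0, l).
    by rewrite [LHS]surjective_pairing e (fE x0 j l) -surjective_pairing.
  exists (perm a_inj), (perm b_inj); left=> i j; rewrite !permE.
  by rewrite [LHS]surjective_pairing (fE i j x0) (hE i x0).
move=> /forallPn[i /forallPn[j /forallPn[l fne]]].
have colj k : (phi (i, j)).1 = (phi (k, j)).1.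
  by case: (fP i k j l) => // e; rewrite e eqxx in fne.
have fne' m : m != j -> (phi (i, j)).1 != (phi (i, m)).1.
  rewrite eq_sym => jm; apply/eqP => e.
  have h_ne := row_ne i j m jm e; have [k ki] := other i.
  case: (hP i k j m) => e2; first by rewrite e2 eqxx in h_ne.
  have := col_ne i k j; rewrite eq_sym ki => /(_ isT (colj k)).
  by rewrite e2 eqxx.
have fE k m : (phi (i, m)).1 = (phi (k, m)).1.
  have [->//|mj] := eqVneq m j.
  by case: (fP i k m j) => // e; have := fne' m mj; rewrite e eqxx.
have hE k m m' : (phi (k, m)).2 = (phi (k, m')).2.
  have [k' k'k] := other k; case: (hP k k' m m') => // e.
  have kk' : k != k' by rewrite eq_sym.
  by have := col_ne k k' m kk' (etrans (esym (fE k m)) (fE k' m)); rewrite e eqxx.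
have a_inj : injective (fun k => (phi (k, j)).2).
  move=> k k' e; have /phi_inj[] // : phi (k, j) = phi (k', j).
  by rewrite [LHS]surjective_pairing e -fE (fE k') -surjective_pairing.
have b_inj : injective (fun m => (phi (i, m)).1).
  move=> m m' e; have /phi_inj[] // : phi (i, m) = phi (i, m').
  by rewrite [LHS]surjective_pairing e (hE i m m') -surjective_pairing.
exists (perm a_inj), (perm b_inj); right=> k m; rewrite !permE.
by rewrite [LHS]surjective_pairing -fE (hE k m j).
Qed.

Section Translation.

Variables (n : nat) (chi : 'S_n -> int).
Hypothesis n5 : (5 <= n)%N.
Hypothesis chiP : immanant_character chi.

Lemma support_translation (tau : 'S_n) :
  (forall s, (chi (s * tau)%g != 0) = (chi s != 0)) -> tau = 1%g.
Proof.
move=> tauP; apply/eqP/negPn/negP => tau1.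
pose H := [set h : 'S_n | [forall s, (chi (s * h)%g != 0) == (chi s != 0)]].
have HP h : reflect (forall s, (chi (s * h)%g != 0) = (chi s != 0)) (h \in H).
  rewrite inE; apply: (iffP forallP) => e s; first by have /eqP := e s.
  by rewrite e.
have gH : group_set H.
  apply/group_setP; split; first by apply/HP => s; rewrite mulg1.
  by move=> x y /HP hx /HP hy; apply/HP => s; rewrite mulgA hy hx.
pose HG := Group gH.
have HJ h g : h \in H -> (h ^ g)%g \in H.
  by move=> /HP hh; apply/HP => s; rewrite -(conjgKV g s) -conjMg !(imchJ chiP) hh (imchJ chiP).
have tauH : tau \in HG by apply/HP.
have [i ti] : exists i, tau i != i.
  apply/existsP; apply: contraNT tau1; rewrite negb_exists => /forallP id0.
  by apply/eqP/permP=> y; rewrite perm1; apply/eqP; have := id0 y; rewrite negbK.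
have [k] : exists k, k \notin [:: i; tau i] by apply: exists_notin; rewrite card_ord /=; lia.
rewrite !inE negb_or => /andP[ki kti].
(* This commutator is the product of [t] and a conjugate of [t], hence even whatever the parity of
   [tau]; the choice of [k] makes it nontrivial, and simplicity of the alternating group applies. *)
pose t := tperm i k; pose u := ((tau^-1) ^ t * tau)%g.
have tVH : (tau^-1)%g \in HG by rewrite groupV.
have uH : u \in HG by rewrite groupM //; apply: HJ tVH.
have uE : u = (t * t ^ tau)%g.
  by rewrite /u /conjg /t tpermV !mulgA.
have u1 : u != 1%g.
  rewrite uE tpermJ; apply: contraNneq ti => e.
  have := congr1 (fun s : 'S_n => s i) e; rewrite permM tpermL perm1.
  case: tpermP => [kE|kE ->|_ _ kE]; rewrite ?eqxx //.
    by rewrite kE eqxx in kti.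
  by rewrite kE eqxx in ki.
have uA : u \in (Alt 'I_n).
  by rewrite Alt_even uE odd_permM odd_permJ addbb.
have simA : simple (Alt 'I_n) by apply: simple_Alt5; rewrite card_ord.
have AH : (Alt 'I_n) \subset HG.
  have nHG : (Alt 'I_n) \subset 'N(HG)%g.
    apply/subsetP=> x _; rewrite inE; apply/subsetP=> y; rewrite mem_conjg => yH.
    by rewrite -(conjgKV x y); apply: HJ.
  have [_ /(_ (HG :&: Alt_group 'I_n)%G)] := simpleP _ simA.
  case; first by rewrite /normal subsetIr normsI // normG.
    by move=> e; case/negP: u1; rewrite -in_set1 -[[set _]]e inE uH; apply: uA.
  by move=> e; apply/setIidPr.
have Aeven h s : ~~ odd_perm h -> (chi (s * h)%g != 0) = (chi s != 0).
  by rewrite -Alt_even => /(subsetP AH)/HP.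
have [z z0] := imch_zero chiP; have [s0 s0_odd s0_neq0] := imch_odd chiP.
have : chi z != 0; last by rewrite z0 eqxx.
(* An even zero would be a translate of 1, an odd one a translate of the odd permutation [s0]. *)
case: (boolP (odd_perm z)) => oz; last first.
  by rewrite -[z]mul1g Aeven // gt_eqF // (imch_gt0 chiP).
by rewrite -(mulKVg s0 z) Aeven // odd_permM odd_permV s0_odd oz.
Qed.

End Translation.

(** * Elements of the stabilizer are monomial *)

Section Stabilizer.

Variables (F : numFieldType) (n : nat) (chi : 'S_n -> int).
Hypothesis n5 : (5 <= n)%N.
Hypothesis chiP : immanant_character chi.

Local Notation imm := (@imm F n chi).
Local Notation chiF s := ((chi s)%:~R : F).

Lemma imm_graph (s : 'S_n) (X : 'M[F]_n) : (forall i j, j != s i -> X i j = 0) ->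
  imm X = chiF s * \prod_i X i (s i).
Proof.
move=> X0; rewrite /imm (bigD1 s) //= [X in _ + X]big1 ?addr0 // => s' ns.
have [i si] : exists i, s' i != s i.
  apply/existsP; apply: contraNT ns; rewrite negb_exists => /forallP eq_s.
  by apply/eqP/permP=> i; apply/eqP; have := eq_s i; rewrite negbK.
by rewrite (bigD1 i) //= X0 // mul0r mulr0.
Qed.

Lemma imm_torus (a b : 'I_n -> F) (X : 'M[F]_n) :
  imm (\matrix_(i, j) (a i * X i j * b j)) = \prod_i a i * \prod_i b i * imm X.
Proof.
rewrite /imm mulr_sumr; apply: eq_bigr => s _.
rewrite [\prod_i b i](reindex_inj (@perm_inj _ s)) /= mulrCA -!big_split /=.
by congr (_ * _); apply: eq_bigr => i _; rewrite mxE mulrAC.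
Qed.

Lemma imm_conj (r : 'S_n) (X : 'M[F]_n) : imm (\matrix_(i, j) X (r i) (r j)) = imm X.
Proof.
rewrite /imm [RHS](reindex_inj (conjg_inj r)) /=; apply: eq_bigr => s _.
rewrite imchJ //; congr (_ * _); rewrite [RHS](reindex_inj (@perm_inj _ r)) /=.
by apply: eq_bigr => i _; rewrite mxE permJ.
Qed.

Lemma imm_tr (X : 'M[F]_n) : imm X^T = imm X.
Proof.
rewrite /imm (reindex_inj invg_inj) /=; apply: eq_bigr => s _.
rewrite imchV //; congr (_ * _); rewrite (reindex_inj (@perm_inj _ s)) /=.
by apply: eq_bigr => i _; rewrite mxE permK.
Qed.

Section Monomial.

Variable g : 'End('M[F]_n).
Hypothesis g_bij : bijective g.
Hypothesis g_imm : forall X, imm (g X) = imm X.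

(** The number [i * n + j] separates the cells. Its sum along the graph of any permutation is [wS],
    so scaling by [n] and subtracting [wS] from each weight makes every such sum 0 and keeps the
    weights distinct. *)
Let wS : F := \sum_(i < n) (i * n)%:R + \sum_(j < n) j%:R.
Let w (i j : 'I_n) : F := n%:R * (i * n + j)%:R - wS.

Let w_inj i j i' j' : w i j = w i' j' -> (i, j) = (i', j').
Proof.
have n0 : (0 < n)%N by apply: leq_trans n5.
move/addIr/mulfI; rewrite pnatr_eq0 -lt0n n0 => /(_ isT) /eqP.
rewrite eqr_nat => /eqP e.
have ei : i = i'.
  apply: val_inj; have := congr1 (divn^~ n) e.
  by rewrite !divnMDl // !divn_small ?ltn_ord // !addn0.
by rewrite ei in e *; congr (_, _); apply: val_inj; apply: (addnI e).
Qed.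

Let B (X : 'M[F]_n) : 'M[F]_n := \matrix_(i, j) (w i j * X i j).

Let B_kill X : imm_deriv chi X (B X) = 0.
Proof.
apply: big1 => s _; rewrite (eq_bigr (fun k => w k (s k) * \prod_i X i (s i))).
  rewrite -mulr_suml sumrB -mulr_sumr sumr_const card_ord.
  have -> : \sum_(i < n) (i * n + s i)%:R = wS.
    rewrite /wS [X in _ = _ + X](reindex_inj (@perm_inj _ s)) -big_split /=.
    by apply: eq_bigr => i _; rewrite natrD.
  by rewrite mulr_natl subrr mul0r mulr0.
by move=> k _; rewrite mxE -mulrA [in RHS](bigD1 k).
Qed.

(* [B] scales the entries by distinct weights and kills the immanant, hence so
   does its conjugate by [g]. The latter is therefore diagonal on elementary
   matrices, and [g] maps its eigenlines to those of [B]. *)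
Lemma stab_monomial : exists (phi : 'I_n * 'I_n -> 'I_n * 'I_n) (c : 'I_n * 'I_n -> F),
  [/\ injective phi, forall u, c u != 0 &
      forall u, g (delta_mx u.1 u.2) = c u *: delta_mx (phi u).1 (phi u).2].
Proof.
have [g' gK g'K] := g_bij.
have g'_add X Y : g' (X + Y) = g' X + g' Y.
  by apply: (can_inj gK); rewrite linearD /= !g'K.
pose A X := g' (B (g X)).
have A_add X Y : A (X + Y) = A X + A Y.
  rewrite /A linearD -g'_add; congr g'.
  by apply/matrixP=> i j; rewrite !mxE mulrDr.
have A_kill X : imm_deriv chi X (A X) = 0.
  have g_lin a Y Z : g (a *: Y + Z) = a *: g Y + g Z by rewrite linearP.
  by rewrite -(imm_deriv_comp g_lin g_imm) /A g'K B_kill.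
have A_diag k l i j := killing_diag n5 chiP A_add A_kill (i := i) (j := j) (k := k) (l := l).
have gP (u : 'I_n * 'I_n) : exists vc : ('I_n * 'I_n) * F,
    vc.2 != 0 /\ g (delta_mx u.1 u.2) = vc.2 *: delta_mx vc.1.1 vc.1.2.
  case: u => k l /=; set E := delta_mx k l.
  have AE : A E = A E k l *: E.
    apply/matrixP=> i j; rewrite !mxE.
    have [/eqP|kl] := eqVneq (i, j) (k, l).
      by rewrite xpair_eqE => /andP[/eqP-> /eqP->]; rewrite !eqxx mulr1.
    rewrite A_diag //; move: kl; rewrite xpair_eqE => /negbTE ->.
    by rewrite mulr0.
  have BE i j : (w i j - A E k l) * g E i j = 0.
    have := congr1 (fun M : 'M_n => g M i j) AE.
    by rewrite /A g'K linearZ /= !mxE => e; rewrite mulrBl e subrr.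
  have E0 : g E != 0.
    rewrite -(linear0 g) (inj_eq (can_inj gK)); apply/eqP => /matrixP/(_ k l).
    by rewrite !mxE !eqxx => /eqP; rewrite oner_eq0.
  have [[i j] /= ij0] : exists u, g E u.1 u.2 != 0.
    apply/existsP; apply: contraNT E0; rewrite negb_exists => /forallP z.
    by apply/eqP/matrixP=> i j; rewrite mxE; apply/eqP; have := z (i, j); rewrite negbK.
  exists ((i, j), g E i j); split=> //=; apply/matrixP=> i' j'; rewrite !mxE.
  have [/eqP|ne] := eqVneq (i', j') (i, j).
    by rewrite xpair_eqE => /andP[/eqP-> /eqP->]; rewrite !eqxx mulr1.
  move: (ne); rewrite xpair_eqE => /negbTE ->; rewrite mulr0.
  apply/eqP; apply: contraNT ne => ij'0; apply/eqP/w_inj.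
  have eqA i1 j1 : g E i1 j1 != 0 -> w i1 j1 = A E k l.
    move=> nz; have /eqP := BE i1 j1; rewrite mulf_eq0 (negbTE nz) orbF subr_eq0.
    by move/eqP.
  by rewrite !eqA.
have [vc vcP] := fin_all_exists gP.
exists (fun u => (vc u).1), (fun u => (vc u).2); split=> [u v e|u|u]; try by case: (vcP u).
have [cu gu] := vcP u; have [cv gv] := vcP v.
have : (vc v).2 *: delta_mx u.1 u.2 = (vc u).2 *: delta_mx v.1 v.2 :> 'M[F]_n.
  by apply: (can_inj gK); rewrite !linearZ /= gu gv e !scalerA mulrC.
move/matrixP/(_ u.1 u.2); rewrite !mxE !eqxx mulr1 => /eqP.
have [->//|uv] := eqVneq u v.
have -> : (u.1 == v.1) && (u.2 == v.2) = false.
  by apply: contraNF uv => /andP[/eqP e1 /eqP e2]; rewrite [u]surjective_pairing e1 e2 -surjective_pairing.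
by rewrite mulr0 (negbTE cv).
Qed.

End Monomial.

End Stabilizer.

(** * The action of the stabilizer on cells *)

Section StabilizerStructure.

Variables (F : numFieldType) (n : nat) (chi : 'S_n -> int).
Hypothesis n5 : (5 <= n)%N.
Hypothesis chiP : immanant_character chi.

Local Notation imm := (@imm F n chi).
Local Notation chiF s := ((chi s)%:~R : F).

Let perm_graph (s : 'S_n) : 'M[F]_n := \matrix_(i, j) (j == s i)%:R.

Let imm_perm_graph s : imm (perm_graph s) = chiF s.
Proof.
rewrite (imm_graph _ (s := s)) => [|i j /negbTE ns]; last by rewrite mxE ns.
by rewrite big1 ?mulr1 // => i _; rewrite mxE eqxx.
Qed.

Lemma monomial_entry (g : 'End('M[F]_n)) (phi : 'I_n * 'I_n -> 'I_n * 'I_n)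
    (c : 'I_n * 'I_n -> F) :
  injective phi ->
  (forall u, g (delta_mx u.1 u.2) = c u *: delta_mx (phi u).1 (phi u).2) ->
  forall X u, g X (phi u).1 (phi u).2 = c u * X u.1 u.2.
Proof.
move=> phi_inj gE X u; rewrite {1}[X]matrix_sum_delta pair_big linear_sum summxE /=.
rewrite (bigD1 u) //= linearZ /= gE !mxE !eqxx mulr1 big1 ?addr0 1?mulrC // => v vu.
rewrite linearZ /= gE !mxE -[_ && _]/((phi u) == (phi v)) (inj_eq phi_inj) eq_sym.
by rewrite (negbTE vu) !mulr0.
Qed.

(** Evaluation on permutation matrices shows that [s |-> al^-1 * s * be] preserves the support. Up
    to conjugation this is a right translation by [be * al^-1], so [al = be], and then [c] has
    product 1 along every permutation of the support. *)
Lemma stab_direct (g : 'M[F]_n -> 'M[F]_n) (al be : 'S_n) (c : 'I_n -> 'I_n -> F) :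
  (forall X, imm (g X) = imm X) -> (forall i j, c i j != 0) ->
  (forall X i j, g X (al i) (be j) = c i j * X i j) ->
  exists a b : 'I_n -> F,
    [/\ forall i, a i != 0, forall i, b i != 0, \prod_i a i * \prod_i b i = 1 &
        forall X i j, g X (al i) (al j) = a i * X i j * b j].
Proof.
move=> g_imm c0 gE.
have chi_c s : chiF s = chiF (al^-1 * s * be)%g * \prod_i c i (s i).
  rewrite -imm_perm_graph -g_imm (imm_graph _ (s := (al^-1 * s * be)%g)) => [|i j].
    congr (_ * _); rewrite (reindex_inj (@perm_inj _ al)) /=; apply: eq_bigr => i _.
    by rewrite !permM permK gE mxE eqxx mulr1.
  rewrite -(permKV al i) -(permKV be j) gE mxE !permM permK (inj_eq perm_inj).
  by move=> /negbTE ->; rewrite mulr0.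
have prod0 (s : 'S_n) : \prod_i c i (s i) != 0 by apply/prodf_neq0.
have e : (be * al^-1)%g = 1%g.
  apply: (support_translation n5 chiP) => s.
  rewrite -(imchJ chiP (s * _)%g al) -!(intr_eq0 F) [chiF s]chi_c.
  rewrite mulf_eq0 (negbTE (prod0 s)) orbF conjgE.
  by rewrite !mulgA mulgKV.
have be_al : be = al by rewrite -[be](mulgKV al) e mul1g.
have [|s s0|a [b [a0 b0 ab cE]]] := support_torus n5 chiP (c := c) => //.
  have /eqP := chi_c s; rewrite be_al -mulgA -conjgE (imchJ chiP).
  rewrite -{1}[chiF s]mulr1 => /eqP /mulfI <- //; by rewrite intr_eq0.
exists a, b; split=> // X i j.
by rewrite -{2}be_al gE cE mulrAC.
Qed.

(* Conjugation by [g] preserves the torus, so [phi] maps rank one arrays to rank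
   one arrays; the array with entry [4 ^ n] on one line and 1 elsewhere, scaled
   by 1/4, tells that line apart. *)
Lemma stab_line_exchange (g : 'End('M[F]_n)) (phi : 'I_n * 'I_n -> 'I_n * 'I_n)
    (c : 'I_n * 'I_n -> F) :
  (forall X, imm (g X) = imm X) -> injective phi -> (forall u, c u != 0) ->
  (forall u, g (delta_mx u.1 u.2) = c u *: delta_mx (phi u).1 (phi u).2) ->
  (forall i k j l, (phi (i, j)).1 = (phi (i, l)).1 \/ (phi (i, j)).1 = (phi (k, j)).1) /\
  (forall i k j l, (phi (i, j)).2 = (phi (i, l)).2 \/ (phi (i, j)).2 = (phi (k, j)).2).
Proof.
move=> g_imm phi_inj c0 gE; have gX := monomial_entry phi_inj gE.
have [psi psiK phiK] := injF_bij phi_inj.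
have rank1 (a b : 'I_n -> F) : (forall i, a i != 0) -> (forall i, b i != 0) ->
    \prod_i a i * \prod_i b i = 1 -> forall i k j l,
    let d i j := a (phi (i, j)).1 * b (phi (i, j)).2 in d i j * d k l = d i l * d k j.
  move=> a0 b0 ab i k j l d.
  have d0 x y : d x y != 0 by rewrite mulf_neq0.
  have [|s s0|a' [b' [_ _ _ dE]]] := support_torus n5 chiP (c := d) => //.
    (* [M] is built so that [g M] is the torus element with factors [a] and [b] applied to the image
       of the graph of [s]; comparing immanants gives [d] product 1 along [s]. *)
    pose M : 'M[F]_n := \matrix_(x, y) (d x y * perm_graph s x y).
    have gM : g M = \matrix_(x, y) (a x * g (perm_graph s) x y * b y).
      apply/matrixP=> x y; rewrite mxE.
      have [[x' y'] xyE] : exists u, phi u = (x, y) by exists (psi (x, y)).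
      have := (gX M (x', y'), gX (perm_graph s) (x', y')).
      rewrite xyE /= => -[-> ->]; rewrite mxE /d xyE /=.
      by rewrite mulrCA -!mulrA; congr (_ * _); rewrite mulrC -!mulrA.
    have := imm_torus chi a b (g (perm_graph s)).
    rewrite -gM !g_imm ab mul1r imm_perm_graph (imm_graph _ (s := s)).
      under eq_bigr => x _ do rewrite mxE mxE eqxx mulr1.
      by rewrite -{2}[chiF s]mulr1 => /mulfI -> //; rewrite intr_eq0.
    by move=> x y /negbTE ns; rewrite !mxE ns mulr0.
  by rewrite !dE mulrACA [RHS]mulrACA; congr (_ * _); rewrite mulrC.
pose q : F := 4%:R; pose Q := q ^+ n.
have q0 : q != 0 by rewrite pnatr_eq0.
have Q1 : 1 < Q by rewrite exprn_egt1 ?(ltr_nat F 1) // -lt0n (leq_trans _ n5).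
have Q0 : Q != 0 by rewrite expf_neq0.
pose a (p : 'I_n) (r : 'I_n) : F := if r == p then Q else 1.
have a_neq0 p r : a p r != 0 by rewrite /a; case: ifP; rewrite ?oner_eq0.
have qV (r : 'I_n) : q^-1 != 0 by rewrite invr_eq0.
have prod_a p : \prod_i a p i * \prod_(i < n) q^-1 = 1.
  rewrite prodr_const card_ord exprVn (bigD1 p) //= /a eqxx big1 ?mulr1 ?divff //.
  by move=> i /negbTE ->.
have a_ge1 p r : 1 <= a p r by rewrite /a; case: ifP => // _; apply: ltW.
have exchange p (x y z t : 'I_n) : a p x * a p y = a p z * a p t -> p = x -> x = z \/ x = t.
  move=> e px; have [->|xz] := eqVneq x z; first by left.
  have [->|xt] := eqVneq x t; first by right.
  move: e; rewrite {1 3 4}/a px eqxx ![_ == x]eq_sym (negbTE xz) (negbTE xt) mulr1 => e.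
  have : 1 < Q * a x y.
    apply: (lt_le_trans Q1); rewrite ler_peMr //; exact: ltW (lt_trans ltr01 Q1).
  by rewrite e ltxx.
have cancel2 (x y z t : F) : x * q^-1 * (y * q^-1) = z * q^-1 * (t * q^-1) -> x * y = z * t.
  by rewrite mulrACA [RHS]mulrACA => /mulIf; apply; rewrite mulf_neq0 ?invr_eq0.
split=> i k j l.
  have := rank1 (a (phi (i, j)).1) (fun=> q^-1) (a_neq0 _) qV (prod_a _) i k j l.
  by move=> /cancel2 /exchange; apply.
have := rank1 (fun=> q^-1) (a (phi (i, j)).2) qV (a_neq0 _) _ i k j l.
rewrite mulrC prod_a => /(_ erefl) /=; rewrite ![q^-1 * _]mulrC.
by move=> /cancel2 /exchange; apply.
Qed.

Lemma stab_structure (g : 'End('M[F]_n)) : bijective g ->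
  (forall X, imm (g X) = imm X) ->
  exists (al : 'S_n) (a b : 'I_n -> F),
    [/\ forall i, a i != 0, forall i, b i != 0, \prod_i a i * \prod_i b i = 1 &
       (forall X i j, g X (al i) (al j) = a i * X i j * b j) \/
       (forall X i j, g X^T (al i) (al j) = a i * X i j * b j)].
Proof.
move=> g_bij g_imm.
have [phi [c [phi_inj c0 gE]]] := stab_monomial n5 chiP g_bij g_imm.
have gX := monomial_entry phi_inj gE.
have [fP hP] := stab_line_exchange g_imm phi_inj c0 gE.
have n1 : (1 < #|'I_n|)%N by rewrite card_ord (leq_trans _ n5).
have [al [be [phiE|phiE]]] := cell_perm_structure phi_inj fP hP n1.
  have [||X i j|a [b [a0 b0 ab gab]]] :=
    @stab_direct g al be (fun i j => c (i, j)) => //.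
    by have := gX X (i, j); rewrite phiE.
  by exists al, a, b; split=> //; left.
have [|//|X i j|a [b [a0 b0 ab gab]]] :=
  @stab_direct (fun X => g X^T) be al (fun i j => c (j, i)) => //.
- by move=> X; rewrite g_imm imm_tr.
- by have := gX X^T (j, i); rewrite phiE /= mxE.
by exists be, a, b; split=> //; right.
Qed.

End StabilizerStructure.

(** * Comparison with the generated group *)

Section Groups.

Variables (F : numFieldType) (n : nat).

Lemma perm_mx_conj (s : 'S_n) (X : 'M[F]_n) :
  perm_mx s *m X *m invmx (perm_mx s) = \matrix_(i, j) X (s i) (s j).
Proof.
have -> : invmx (perm_mx s) = perm_mx (s^-1)%g :> 'M[F]_n.
  rewrite -[RHS](mulKmx (unitmx_perm F s)) -perm_mxM mulgV perm_mx1.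
  by rewrite mulmx1.
by rewrite -col_permE -row_permE; apply/matrixP=> i j; rewrite !mxE.
Qed.

Lemma direct_in_group (g : 'End('M[F]_n)) (al : 'S_n) (a b : 'I_n -> F) :
  (forall i, a i != 0) -> (forall i, b i != 0) -> \prod_i a i * \prod_i b i = 1 ->
  (forall X i j, g X (al i) (al j) = a i * X i j * b j) ->
  perm_torus_transpose_group F n g.
Proof.
move=> a0 b0 ab gE.
(* Conjugation by [perm_mx s] reads the entry at (s i, s j), so carrying entry (i, j) to (al i, al
   j) takes the inverse of [al]. *)
pose P : 'M[F]_n := perm_mx (al^-1)%g.
pose D1 := diag_mx (\row_i a i); pose D2 := diag_mx (\row_i b i).
pose g1 : 'End('M[F]_n) := linfun (mulmxr (invmx P) \o mulmx P).
pose g2 : 'End('M[F]_n) := linfun (mulmxr D2 \o mulmx D1).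
have det_row (d : 'I_n -> F) : \det (diag_mx (\row_i d i)) = \prod_i d i.
  by rewrite det_diag; apply: eq_bigr => i _; rewrite mxE.
have unit_row (d : 'I_n -> F) : (forall i, d i != 0) -> diag_mx (\row_i d i) \in unitmx.
  by move=> d0; rewrite unitmxE det_row unitfE; apply/prodf_neq0.
have -> : g = (g1 \o g2)%VF.
  apply/lfunP => X; rewrite comp_lfunE !lfunE /=.
  apply/matrixP=> i j; rewrite -(permKV al i) -(permKV al j) gE.
  rewrite perm_mx_conj mxE !permK.
  by rewrite mul_mx_diag mxE mul_diag_mx !mxE.
apply: gen_comp; apply: gen_incl.
  by left; left; exists (al^-1)%g => X; rewrite lfunE.
left; right; exists D1, D2; split; rewrite ?diag_mx_is_diag ?unit_row ?det_row //.
by move=> X; rewrite lfunE.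
Qed.

Lemma tr_in_group (g : 'End('M[F]_n)) :
  perm_torus_transpose_group F n (g \o linfun trmx)%VF ->
  perm_torus_transpose_group F n g.
Proof.
pose T : 'End('M[F]_n) := linfun trmx => gT.
have -> : g = ((g \o T) \o T)%VF.
  by apply/lfunP => X; rewrite !comp_lfunE !lfunE /= trmxK.
by apply: gen_comp gT _; apply: gen_incl; right=> X; rewrite lfunE.
Qed.

Lemma group_stab (chi : 'S_n -> int) (g : 'End('M[F]_n)) :
  immanant_character chi -> perm_torus_transpose_group F n g ->
  bijective g /\ forall X, imm chi (g X) = imm chi X.
Proof.
move=> chiP; elim=> {g}.
- move=> g [[[s gE]|[D1 [D2 [/andP[/diag_mxP[a ->] u1] /andP[/diag_mxP[b ->] u2] det1 gE]]]]|gE].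
  + have gE' X : g X = \matrix_(i, j) X (s i) (s j) by rewrite gE perm_mx_conj.
    split=> [|X]; last by rewrite gE' (imm_conj chiP).
    by exists (fun X : 'M[F]_n => \matrix_(i, j) X (s^-1 i)%g (s^-1 j)%g) => X;
      rewrite gE'; apply/matrixP=> i j; rewrite !mxE ?permK ?permKV.
  + split=> [|X].
      exists (fun X => invmx (diag_mx a) *m X *m invmx (diag_mx b)) => X; rewrite gE.
        by rewrite !mulmxA mulVmx // mul1mx mulmxK.
      by rewrite !mulmxA mulmxV // mul1mx mulmxKV.
    rewrite -[RHS]mul1r -det1 !det_diag -imm_torus gE; congr (imm _ _).
    by apply/matrixP=> i j; rewrite mul_mx_diag mxE mul_diag_mx !mxE.
  split=> [|X]; last by rewrite gE (imm_tr chiP).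
  by exists trmx => X; rewrite gE trmxK.
- by split=> [|X]; [exists id => X; rewrite id_lfunE | rewrite id_lfunE].
- move=> g h _ [g_bij g_imm] _ [h_bij h_imm]; split=> [|X].
    by apply: (eq_bij (bij_comp g_bij h_bij)) => X; rewrite comp_lfunE.
  by rewrite comp_lfunE g_imm h_imm.
move=> g _ [g_bij g_imm]; have gK : cancel g (g^-1)%VF.
  by apply/lker0_lfunK/lker0P/(bij_inj g_bij).
have gVK : cancel (g^-1)%VF g by apply/(bij_can_sym g_bij).
split=> [|X]; first by exists g.
by rewrite -g_imm gVK.
Qed.

End Groups.

Lemma immanant_character_specht (n : nat) (p : seq nat) : is_intpart n p ->
  p <> conj_intpart p -> p <> nseq n 1%N -> p <> [:: n] ->
  immanant_character (@specht_val n p).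
Proof.
move=> hp hsym hcol hrow; split.
- exact: specht_valJ.
- exact: specht_valV.
- exact: specht_val_central.
- exact: specht_val1_gt0.
- exact: sum_specht_val_sqr.
- exact: dvd_specht_val1.
- have [s s_odd Ns] := young_avg_odd hp (young_avgV hp) hsym.
  exists s => //; apply: contra_neq Ns => chi0.
  by rewrite -specht_val_mulr // chi0 mul0r.
exact/specht_val_zero/specht_val1_neq1.
Qed.

Theorem theorem1p7 (R : realType) (n : nat) (hn : (5 <= n)%N)
  (p : seq nat) (hp : is_intpart n p) (hsym : p <> conj_intpart p)
  (hcol : p <> nseq n 1%N) (hrow : p <> [:: n]) :
  immanant_stab R[i] n p = perm_torus_transpose_group R[i] n.
Proof.
have chiP := immanant_character_specht hp hsym hcol hrow.
have immE (X : 'M[R[i]]_n) : immanant p X = imm (@specht_val n p) X.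
  by apply: eq_bigr => s _; rewrite specht_char_val.
apply/seteqP; split=> g; last first.
  move=> /(group_stab chiP) [g_bij g_imm].
  by split=> // X; rewrite !immE.
move=> [g_bij g_imm].
have [|al [a [b [a0 b0 ab gE]]]] := stab_structure hn chiP g_bij.
  by move=> X; rewrite -!immE.
case: gE => gE; first exact: direct_in_group gE.
apply/tr_in_group/(direct_in_group (al := al) a0 b0 ab) => X i j.
by rewrite comp_lfunE lfunE gE.
Qed.
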